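(* Let $P,\tilde P\in\mathbb{C}[x_1,\dots,x_n]$ be arbitrary nil-polynomials arising from admissible algebras $\mathcal{N}$, $\tilde{\mathcal{N}}$, respectively, and let $S=\{(x_0,x)\in\mathbb{C}\times\mathbb{C}^n: x_0=P(x)\}$ and $\tilde S=\{(x_0,x)\in\mathbb{C}\times\mathbb{C}^n: x_0=\tilde P(x)\}$ be their graphs in $\mathbb{C}^{n+1}$. If at least one of the hypersurfaces $S$, $\tilde S$ is affinely homogeneous (e.g. if one of $\mathcal{N}$, $\tilde{\mathcal{N}}$ admits a grading), then the following conditions are equivalent: (i) $\mathcal{N}$ and $\tilde{\mathcal{N}}$ are isomorphic as associative algebras; (ii) $S$ and $\tilde S$ are affinely equivalent; (iii) $S$ and $\tilde S$ are linearly equivalent; (iv) $P$ and $\tilde P$ are linearly equivalent; (v) there exist $c\in\mathbb{C}^*$ and $C\in\mathrm{GL}(n,\mathbb{C})$ such that $c\cdot\tilde P^{[\ell]}(x)=P^{[\ell]}(Cx)$ for $\ell=2,3$ and all $x\in\mathbb{C}^n$.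
   Context: All algebras are over $\mathbb{C}$. A finite-dimensional commutative associative algebra $\mathcal{N}$ is nilpotent if $\mathcal{N}^{\nu+1}=0$ for some $\nu\ge 0$, where $\mathcal{N}^1:=\mathcal{N}$ and $\mathcal{N}^{j+1}$ is the linear span of $\mathcal{N}\,\mathcal{N}^j$. Its annihilator is $\mathrm{Ann}(\mathcal{N}):=\{u\in\mathcal{N}: u\,\mathcal{N}=0\}$. A nilpotent finite-dimensional commutative associative algebra $\mathcal{N}$ is called admissible if $\dim\mathrm{Ann}(\mathcal{N})=1$. It admits a grading if $\mathcal{N}=\bigoplus_{j>0}\mathcal{N}_j$ for linear subspaces $\mathcal{N}_j$ (indexed by positive integers) with $\mathcal{N}_j\mathcal{N}_m\subset\mathcal{N}_{j+m}$. For $u\in\mathcal{N}$ put $\exp_2(u):=\sum_{m\ge 2}\frac{u^m}{m!}$ (a finite sum). For a finite-dimensional complex vector space $W$, let $\mathbb{C}[W]$ be the algebra of complex-valued polynomials on $W$; for $W=\mathbb{C}^n$ this is $\mathbb{C}[x_1,\dots,x_n]$. A polynomial $P\in\mathbb{C}[W]$ is a nil-polynomial, arising from the admissible algebra $\mathcal{N}$, if there exist a linear form $\omega:\mathcal{N}\to\mathbb{C}$ with $\omega(\mathrm{Ann}(\mathcal{N}))=\mathbb{C}$ and a linear isomorphism $\varphi:W\to\ker\omega$ such that $P=\omega\circ\exp_2\circ\varphi$. $P^{[\ell]}$ denotes the homogeneous component of degree $\ell$ of $P$. Two nil-polynomials $P\in\mathbb{C}[W]$, $\tilde P\in\mathbb{C}[\tilde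 W]$ are linearly equivalent if there exist a linear isomorphism $g:W\to\tilde W$ and $r\in\mathbb{C}^*$ with $P=r\cdot\tilde P\circ g$. Two hypersurfaces in complex vector spaces are affinely (resp. linearly) equivalent if there is a complex affine (resp. linear) isomorphism between the ambient spaces mapping one onto the other. A hypersurface is affinely homogeneous if the group of complex affine automorphisms of the ambient space preserving it acts transitively on it. *)

(* Defs.v *)
From HB Require Import structures.
From mathcomp Require Import all_boot all_order all_algebra.
From mathcomp Require Import classical_sets reals complex mpoly.

Set Implicit Arguments.
Unset Strict Implicit.
Unset Printing Implicit Defensive.

Import GRing.Theory.

Local Open Scope ring_scope.
Local Open Scope classical_set_scope.

(* Finite-dimensional commutative associative algebras, not assumed unital.   *)
(* Linearity in the second argument follows from commutativity.               *)
Record calg (K : fieldType) := Calg {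
  calg_sort :> vectType K;
  cmul : calg_sort -> calg_sort -> calg_sort;
  cmul_linearl : forall v, linear (cmul^~ v);
  cmulC : commutative cmul;
  cmulA : associative cmul
}.

Arguments cmul {K c} u v.

Lemma cmul_linear (K : fieldType) (N : calg K) (u : N) : linear (cmul u).
Proof. by move=> a v w; rewrite !(cmulC u) (cmul_linearl u a v w). Qed.

HB.instance Definition _ (K : fieldType) (N : calg K) (u : N) :=
  GRing.isLinear.Build K N N *:%R (cmul u) (cmul_linear u).

Definition lmulv (K : fieldType) (N : calg K) (u : N) : 'End(N) :=
  linfun (cmul u).

Lemma lmulv_linear (K : fieldType) (N : calg K) : linear (@lmulv K N).
Proof.
move=> a u v; apply/lfunP => w.
by rewrite add_lfunE scale_lfunE !lfunE /= (cmul_linearl w a u v).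
Qed.

HB.instance Definition _ (K : fieldType) (N : calg K) :=
  GRing.isLinear.Build K N 'End(N) *:%R (@lmulv K N) (@lmulv_linear K N).

(* The annihilator, as the kernel of u |-> (v |-> u v); see annP.             *)
Definition ann (K : fieldType) (N : calg K) : {vspace N} :=
  lker (linfun (@lmulv K N)).

Lemma annP (K : fieldType) (N : calg K) (u : N) :
  reflect (forall v, cmul u v = 0) (u \in ann N).
Proof.
rewrite memv_ker lfunE /=; apply: (iffP eqP) => [u0 v|u0].
  by have := congr1 (fun f : 'End(N) => f v) u0; rewrite lfunE zero_lfunE.
by apply/lfunP => v; rewrite lfunE zero_lfunE /= u0.
Qed.

(* The linear span of all products of an element of U and an element of V,    *)
(* computed on bases; see memv_cprod and cprod_sub.                           *)
Definition cprod (K : fieldType) (N : calg K) (U V : {vspace N}) : {vspace N} :=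
  <<[seq cmul u v | u <- vbasis U, v <- vbasis V]>>%VS.

Lemma memv_cprod (K : fieldType) (N : calg K) (U V : {vspace N}) (u v : N) :
  u \in U -> v \in V -> cmul u v \in cprod U V.
Proof.
move=> /coord_vbasis -> /coord_vbasis ->.
rewrite linear_sum; apply: memv_suml => j _.
rewrite linearZ /= memvZ // cmulC linear_sum; apply: memv_suml => i _.
rewrite linearZ /= memvZ // cmulC; apply/memv_span/allpairsP.
by exists ((vbasis U)`_i, (vbasis V)`_j);
  split; rewrite ?mem_nth ?size_tuple.
Qed.

Lemma cprod_sub (K : fieldType) (N : calg K) (U V W : {vspace N}) :
  (forall u v, u \in U -> v \in V -> cmul u v \in W) -> (cprod U V <= W)%VS.
Proof.
move=> UVW; apply/span_subvP => _ /allpairsP[[u v] [/= uU vV ->]].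
by apply: UVW; apply: vbasis_mem.
Qed.

(* cpow N j is the ideal N^(j+1).                                             *)
Definition cpow (K : fieldType) (N : calg K) (j : nat) : {vspace N} :=
  iter j (cprod fullv) fullv.

Definition nilpotent (K : fieldType) (N : calg K) : Prop :=
  exists nu : nat, cpow N nu = 0%VS.

Definition admissible (K : fieldType) (N : calg K) : Prop :=
  nilpotent N /\ \dim (ann N) = 1%N.

(* The homogeneous components are the G j with j > 0 (G 0 is unused). By      *)
(* finite dimension only finitely many are nonzero, hence the bound k.        *)
Definition graded (K : fieldType) (N : calg K) : Prop :=
  exists (G : nat -> {vspace N}) (k : nat),
    [/\ forall j, (k < j)%N -> G j = 0%VS,
        (\sum_(j < k) G j.+1)%VS = fullv,
        directv (\sum_(j < k) G j.+1)%VS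
      & forall (j m : nat) (u v : N), (0 < j)%N -> (0 < m)%N ->
          u \in G j -> v \in G m -> cmul u v \in G (j + m)%N].

(* u^m, for m > 0.                                                            *)
Definition cexp (K : fieldType) (N : calg K) (u : N) (m : nat) : N :=
  iter m.-1 (cmul u) u.

(* The sum of u^m / m! over all m >= 2: in a nilpotent algebra u^m vanishes   *)
(* as soon as m exceeds the dimension; see exp2E.                             *)
Definition exp2 (K : fieldType) (N : calg K) (u : N) : N :=
  \sum_(2 <= m < (\dim {:N}).+1) (m`!%:R^-1 : K) *: cexp u m.

Lemma cprodS (K : fieldType) (N : calg K) (U V W : {vspace N}) :
  (V <= W)%VS -> (cprod U V <= cprod U W)%VS.
Proof.
move=> /subvP VW; apply: cprod_sub => u v uU vV.
by apply: memv_cprod => //; apply: VW.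
Qed.

Lemma cpowS_sub (K : fieldType) (N : calg K) (j : nat) :
  (cpow N j.+1 <= cpow N j)%VS.
Proof. by elim: j => [|j IHj]; [exact: subvf | exact: cprodS]. Qed.

Lemma cpow_dim (K : fieldType) (N : calg K) :
  nilpotent N -> cpow N (\dim {:N}) = 0%VS.
Proof.
move=> [nu nu0].
have stat j : cpow N j.+1 = cpow N j -> cpow N j = 0%VS.
  move=> jE.
  have jiE i : cpow N (i + j) = cpow N j.
    by elim: i => [//|i IHi]; rewrite -jE addSn /= -/(cpow N (i + j)) IHi.
  have sub0 i : (cpow N (i + nu) <= 0)%VS.
    elim: i => [|i IHi]; first by rewrite nu0.
    by apply: subv_trans IHi; exact: cpowS_sub.
  by apply/eqP; rewrite -subv0 -(jiE nu) addnC; apply: sub0.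
have dimj j : cpow N j = 0%VS \/ (\dim (cpow N j) + j <= \dim {:N})%N.
  elim: j => [|j [j0|IHj]]; first by right; rewrite addn0.
    by left; apply/eqP; rewrite -subv0 -j0 cpowS_sub.
  have [/stat j0|neq] := eqVneq (cpow N j.+1) (cpow N j).
    by left; apply/eqP; rewrite -subv0 -j0 cpowS_sub.
  right; apply: leq_trans IHj; rewrite addnS -addSn leq_add2r.
  rewrite ltn_neqAle dimvS ?cpowS_sub // andbT.
  by apply: contra neq => /eqP dE; rewrite eqEdim cpowS_sub dE leqnn.
have [//|] := dimj (\dim {:N}).
by rewrite -[leqRHS]add0n leq_add2r leqn0 dimv_eq0 => /eqP.
Qed.

Lemma exp2E (K : fieldType) (N : calg K) (u : N) (M : nat) :
  nilpotent N -> (\dim {:N} <= M)%N ->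
  exp2 u = \sum_(2 <= m < M.+1) (m`!%:R^-1 : K) *: cexp u m.
Proof.
move=> nilN leM.
have mem_cexp j : cexp u j.+1 \in cpow N j.
  by elim: j => [|j IHj]; [exact: memvf | apply: memv_cprod; rewrite ?memvf].
have cexp0 m : (\dim {:N} < m)%N -> cexp u m = 0.
  case: m => // m; rewrite ltnS => /subnKC <-; set i := (m - _)%N.
  elim: i => [|i IHi].
    by rewrite addn0; apply/eqP; rewrite -memv0 -(cpow_dim nilN).
  by rewrite addnS [LHS](_ : _ = cmul u (cexp u (\dim {:N} + i).+1)) // IHi
             linear0.
rewrite /exp2 (big_nat_widen _ _ M.+1) // [LHS]big_mkcond /=.
by apply: eq_bigr => m _; case: ltnP => // /cexp0 ->; rewrite scaler0.
Qed.

Definition calg_iso (K : fieldType) (N N' : calg K) : Prop :=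
  exists f : {linear N -> N'},
    bijective f /\ forall u v, f (cmul u v) = cmul (f u) (f v).

Definition mpeval (K : fieldType) (n : nat) (P : {mpoly K[n]}) (x : 'cV[K]_n)
  : K := P.@[fun i => x i 0].

Definition nil_polynomial (K : fieldType) (N : calg K) (n : nat)
    (P : {mpoly K[n]}) : Prop :=
  exists (omega : 'Hom(N, K^o)) (phi : 'Hom('cV[K]_n, N)),
    [/\ (omega @: ann N)%VS = fullv,
        lker phi = 0%VS, limg phi = lker omega
      & forall x, mpeval P x = omega (exp2 (phi x))].

Definition hcomp (K : fieldType) (n : nat) (l : nat) (P : {mpoly K[n]})
  : {mpoly K[n]} := pihomog mdeg l P.

Definition lin_equiv_poly (K : fieldType) (n : nat) (P Q : {mpoly K[n]})
  : Prop :=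
  exists (g : {linear 'cV[K]_n -> 'cV[K]_n}) (r : K),
    [/\ bijective g, r != 0 & forall x, mpeval P x = r * mpeval Q (g x)].

Definition graph (K : fieldType) (n : nat) (P : {mpoly K[n]})
  : set (K^o * 'cV[K]_n)%type := [set p | p.1 = mpeval P p.2].

Definition affine_iso (K : fieldType) (V W : lmodType K) (f : V -> W) : Prop :=
  exists (g : {linear V -> W}) (b : W), bijective g /\ forall x, f x = g x + b.

Definition aff_equiv (K : fieldType) (V W : lmodType K)
    (S : set V) (T : set W) : Prop :=
  exists f : V -> W, affine_iso f /\ f @` S = T.

Definition lin_equiv (K : fieldType) (V W : lmodType K)
    (S : set V) (T : set W) : Prop :=
  exists f : {linear V -> W}, bijective f /\ f @` S = T.

Definition aff_homogeneous (K : fieldType) (V : lmodType K) (S : set V)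
  : Prop :=
  forall p q, S p -> S q ->
    exists f : V -> V, [/\ affine_iso f, f @` S = S & f p = q].

(* Main.v *)
Require Import Defs.
From HB Require Import structures.
From mathcomp Require Import all_boot all_order all_algebra.
From mathcomp Require Import zify ring.
From mathcomp Require boolp.
From mathcomp Require Import classical_sets reals complex mpoly.

Set Implicit Arguments.
Unset Strict Implicit.
Unset Printing Implicit Defensive.

Import GRing.Theory Num.Theory.

Local Open Scope ring_scope.

(** Throughout, write E(y) = y + exp2 y, which is exp y - 1, so that
    E(x + y) = E(x) + E(y) + E(x)E(y).  If omega is the linear form of a
    nil-polynomial P and a spans the annihilator, with omega(a) = 1, then
    (s, x) |-> phi x - s a carries the graph of P linearly onto the locus
    omega(E(y)) = 0 of the algebra itself (graph_exp_locus).

    The algebraic tool is the nondegeneracy of (u, v) |-> omega(uv) modulo the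
    annihilator (mul_form_nondegenerate): in a nilpotent algebra every nonzero
    ideal contains a nonzero element of the annihilator.  Hence a form vanishing
    on the annihilator is omega(c -) for some c (functional_mulP).  As E is
    onto, two forms that are nonzero on the annihilator differ, up to a scalar,
    by multiplication by some exp d, and the functional equation turns this
    multiplication into a translation of the loci (exp_locus_translate).  So
    isomorphic algebras have affinely equivalent graphs.

    If moreover the algebra is graded, then for u in the algebra the map that
    multiplies the component of degree j by (1 + u)^j is an endomorphism.
    Composing such maps, one moves any form to any other one that agrees with
    it on the annihilator (graded_transitive), and the resulting affine maps
    y |-> q + L(y - p) act transitively on the locus (graded_homogeneous).

    Homogeneity of one graph makes an affine equivalence of graphs into one
    that fixes the origin, that is, a linear one (affine_graph_linear).  Such a
    linear map preserves the tangent hyperplane s = 0 at the origin, hence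
    yields A P(x) = P'(g x + P(x) B).  The terms of degree 2 and 3 in x show
    that B changes the cubic form by the product of a linear form with the
    quadratic form.  But the cubic form of a nil-polynomial is trace-free with
    respect to its quadratic form, since multiplication operators are
    nilpotent, and the trace of that product is n + 2 times its linear factor,
    up to a nonzero constant; so B = 0 (shear_eq0) and P and P' are linearly
    equivalent (graph_linear_poly).

    Finally the quadratic form omega(uv) and the cubic form omega(uvw) together
    determine the product, by nondegeneracy (calg_iso_forms), so the components
    of degree 2 and 3 determine the algebra. *)

(** * The unitization and truncated exponentials *)

(** Powers, exponentials and the binomial formula are only convenient in a
    unital ring, so the algebra is embedded in its unitization. *)
Definition unitization (K : fieldType) (N : calg K) : Type := (K^o * N)%type.

HB.instance Definition _ (K : fieldType) (N : calg K) :=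
  GRing.Lmodule.copy (unitization N) (K^o * N)%type.

Section Unitization.
Context {K : fieldType} {N : calg K}.

Definition umul (p q : unitization N) : unitization N :=
  (p.1 * q.1, p.1 *: q.2 + q.1 *: p.2 + cmul p.2 q.2).

Lemma cmulDr (u v w : N) : cmul u (v + w) = cmul u v + cmul u w.
Proof. exact: linearD. Qed.

Lemma cmulDl (u v w : N) : cmul (v + w) u = cmul v u + cmul w u.
Proof. by rewrite !(cmulC _ u) cmulDr. Qed.

Lemma cmulZr a (u v : N) : cmul u (a *: v) = a *: cmul u v.
Proof. exact: linearZ. Qed.

Lemma cmulZl a (u v : N) : cmul (a *: v) u = a *: cmul v u.
Proof. by rewrite !(cmulC _ u) cmulZr. Qed.

Lemma cmul0r (u : N) : cmul u 0 = 0.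
Proof. exact: linear0. Qed.

Lemma cmul0l (u : N) : cmul 0 u = 0.
Proof. by rewrite cmulC cmul0r. Qed.

Lemma cexpS (u : N) m : cexp u m.+2 = cmul u (cexp u m.+1).
Proof. by []. Qed.

Lemma umulA : associative umul.
Proof.
move=> [a u] [b v] [c w]; rewrite /umul /=; congr pair; first exact: mulrA.
rewrite !(cmulDr, cmulDl, cmulZr, cmulZl, scalerDr, scalerA, cmulA).
rewrite (mulrC c a) (mulrC c b).
by rewrite [LHS](AC (4*3)%AC ((1*(2*4*6))*(3*5*7))%AC).
Qed.

Lemma umulC : commutative umul.
Proof.
move=> [a u] [b v]; rewrite /umul /= mulrC cmulC.
by congr (_, _ + _); rewrite addrC.
Qed.

Lemma umul1 : left_id ((1, 0) : unitization N) umul.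
Proof.
by move=> [a u]; rewrite /umul /= mul1r scale1r scaler0 addr0 cmul0l addr0.
Qed.

Lemma umulDl : left_distributive umul +%R.
Proof.
move=> [a u] [b v] [c w]; rewrite /umul /=.
congr pair; first by rewrite /= mulrDl.
rewrite /= scalerDl scalerDr cmulDl.
by rewrite [LHS](AC (2*2*2)%AC ((1*3*5)*(2*4*6))%AC).
Qed.

Lemma uone_neq0 : ((1, 0) : unitization N) != 0.
Proof. by apply/eqP => -[/eqP]; rewrite oner_eq0. Qed.

HB.instance Definition _ := GRing.Zmodule_isComNzRing.Build (unitization N)
  umulA umulC umul1 umulDl uone_neq0.

Lemma uscaleAl (a : K) (p q : unitization N) : a *: (p * q) = (a *: p) * q.
Proof.
case: p q => [b u] [c v]; congr pair; rewrite /=.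
  by rewrite /GRing.scale /= mulrA.
by rewrite !scalerDr !scalerA cmulZl (mulrC a c).
Qed.

HB.instance Definition _ :=
  GRing.Lmodule_isLalgebra.Build K (unitization N) uscaleAl.
HB.instance Definition _ :=
  GRing.Lalgebra_isComAlgebra.Build K (unitization N).

Definition uinj (u : N) : unitization N := (0, u).

Lemma uinjX (u : N) m : uinj u ^+ m.+1 = uinj (cexp u m.+1).
Proof.
elim: m => [|m IHm]; first by rewrite expr1.
rewrite exprS IHm cexpS /uinj.
by congr pair; rewrite /= ?mulr0 // !scale0r !add0r.
Qed.

Lemma uinjM (u v : N) : uinj (cmul u v) = uinj u * uinj v.
Proof. by congr pair; rewrite /= ?mulr0 // !scale0r !add0r. Qed.

Lemma uinjD (u v : N) : uinj (u + v) = uinj u + uinj v.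
Proof. by congr pair; rewrite /= addr0. Qed.

Lemma uinjZ a (u : N) : uinj (a *: u) = a *: uinj u.
Proof. by congr pair; rewrite /= scaler0. Qed.

Lemma uinj_inj : injective uinj.
Proof. by move=> u v []. Qed.

End Unitization.

Definition texp (K : fieldType) (A : comAlgType K) (M : nat) (x : A) : A :=
  \sum_(i < M) (i`!%:R^-1 : K) *: x ^+ i.

Lemma texp_widen (K : fieldType) (A : comAlgType K) (x : A) M L :
  x ^+ M = 0 -> (M <= L)%N -> texp L x = texp M x.
Proof.
move=> x0 leML; rewrite /texp.
rewrite (big_ord_widen _ (fun i => (i`!%:R^-1 : K) *: x ^+ i) leML).
rewrite [RHS]big_mkcond; apply: eq_bigr => i _; case: ltnP => // leMi.
by rewrite -(subnKC leMi) exprD x0 mul0r scaler0.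
Qed.

(** The binomial formula; the truncation at M + M loses nothing because a
    monomial of total degree at least M + M has one exponent at least M. *)
Lemma texpD (K : numFieldType) (A : comAlgType K) (x y : A) M :
  x ^+ M = 0 -> y ^+ M = 0 -> texp (M + M) (x + y) = texp M x * texp M y.
Proof.
move=> x0 y0.
rewrite -(texp_widen x0 (leq_addr M M)) -(texp_widen y0 (leq_addr M M)).
set L := (M + M)%N.
pose F i j : A := ((i`!%:R^-1 * j`!%:R^-1 : K)) *: (x ^+ i * y ^+ j).
have F0 i j : (L <= i + j)%N -> F i j = 0.
  move=> leL; rewrite /F; have [leMi|ltiM] := leqP M i.
    by rewrite -(subnKC leMi) exprD x0 !mul0r scaler0.
  have leMj : (M <= j)%N.
    by rewrite -(leq_add2l M) (leq_trans leL) // leq_add2r ltnW.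
  by rewrite -(subnKC leMj) exprD y0 mul0r mulr0 scaler0.
have -> : texp L x * texp L y = \sum_(i < L) \sum_(j < L) F i j.
  rewrite /texp mulr_suml; apply: eq_bigr => i _; rewrite mulr_sumr.
  by apply: eq_bigr => j _; rewrite /F -scalerAl -scalerAr scalerA.
have -> : texp L (x + y) =
    \sum_(m < L) \sum_(i < L | (i <= m)%N) F (m - i)%N i.
  apply: eq_bigr => m _; rewrite exprDn scaler_sumr.
  rewrite (big_ord_widen _ (fun i => (m`!%:R^-1 : K) *:
    (x ^+ (m - i) * y ^+ i *+ 'C(m, i))) (ltn_ord m)).
  apply: eq_bigr => i; rewrite ltnS => leim; rewrite -scaler_nat scalerA /F.
  congr (_ *: _); have := bin_fact leim => /(congr1 (fun k => k%:R : K)).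
  have nzC : ('C(m, i)%:R : K) != 0 by rewrite pnatr_eq0 -lt0n bin_gt0.
  by rewrite !natrM => <-; rewrite invfM mulrAC mulVf // mul1r invfM mulrC.
(* Both sums run over the triangle i + j < L, outside which F vanishes. *)
rewrite (exchange_big_dep xpredT) //= [RHS]exchange_big /=.
apply: eq_bigr => j _.
rewrite [RHS](bigID (fun i : 'I_L => (i + j < L)%N)) /=.
rewrite [X in _ = _ + X]big1 ?addr0; last by move=> i; rewrite -leqNgt => /F0.
pose G m := if (j <= m)%N then F (m - j)%N j else 0.
transitivity (\sum_(0 <= m < L) G m).
  by rewrite big_mkord big_mkcond.
rewrite (big_cat_nat (n := j)) //=; last exact: ltnW.
rewrite big_nat_cond big1 ?add0r; last first.
  by move=> m; rewrite andbT /G => /andP[_]; rewrite ltnNge => /negbTE ->.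
rewrite -{1}[nat_of_ord j]add0n big_addn.
transitivity (\sum_(0 <= i < L - j) F i j).
  by apply: eq_bigr => i _; rewrite /G leq_addl addnK.
rewrite big_mkord (big_ord_widen _ (fun i => F i j) (leq_subr j L)).
by apply: eq_bigl => i; rewrite ltn_subRL addnC.
Qed.

(** * The map exp - 1 on a nilpotent algebra *)

Definition expm1 (K : fieldType) (N : calg K) (u : N) : N := u + exp2 u.

Section Exponential.
Context {K : numFieldType} {N : calg K}.
Hypothesis nilN : nilpotent N.

Lemma cexp_nilp (u : N) : cexp u (\dim {:N}).+1 = 0.
Proof.
apply/eqP; rewrite -memv0 -(cpow_dim nilN).
elim: (\dim _) => [|j IHj]; first exact: memvf.
by rewrite cexpS memv_cprod ?memvf.
Qed.

Lemma uinj_nilp (u : N) : uinj u ^+ (\dim {:N}).+2 = 0.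
Proof. by rewrite exprS uinjX cexp_nilp mulr0. Qed.

Lemma texp_uinj (u : N) : texp (\dim {:N}).+2 (uinj u) = 1 + uinj (expm1 u).
Proof.
rewrite /texp big_ord_recl big_ord_recl /= expr0 expr1.
rewrite -[(bump 0 0)`!]/1%N -[0`!]/1%N invr1 !scale1r uinjD.
rewrite (exp2E u nilN (leqnSn _)).
congr (1 + (_ + _)); rewrite -[2%N]/(0 + 2)%N big_addn subn2 big_mkord.
rewrite (big_morph uinj uinjD (id1 := 0)) //; apply: eq_bigr => i _.
by rewrite uinjZ !addn2 uinjX.
Qed.

(** This is exp (u + v) = exp u * exp v, read off in the unitization. *)
Lemma expm1D (u v : N) :
  expm1 (u + v) = expm1 u + expm1 v + cmul (expm1 u) (expm1 v).
Proof.
apply: uinj_inj; apply: (addrI 1); rewrite -texp_uinj uinjD.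
rewrite -(texp_widen _ (leq_addr (\dim {:N}).+2 _)); last first.
  by rewrite -uinjD uinj_nilp.
rewrite texpD ?uinj_nilp // !texp_uinj (uinjD _ (cmul _ _)) (uinjD (expm1 u))
  uinjM.
by rewrite mulrDl mul1r mulrDr mulr1 [LHS](AC (2*2)%AC ((1*((3*2)*4)))%AC).
Qed.

Lemma expm1_ann (u : N) : u \in ann N -> expm1 u = u.
Proof.
move=> /annP u0; rewrite /expm1 /exp2 big_nat big1 ?addr0 // => -[|[|m]] // _.
by rewrite cexpS u0 scaler0.
Qed.

Lemma expm1D_ann (u v : N) : v \in ann N -> expm1 (u + v) = expm1 u + v.
Proof.
move=> annv; rewrite expm1D (expm1_ann annv) (cmulC _ v).
by move/annP: annv => ->; rewrite addr0.
Qed.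

Lemma exp2_cpow (u : N) m : u \in cpow N m -> exp2 u \in cpow N m.+1.
Proof.
move=> um; rewrite /exp2 big_nat; apply: memv_suml => -[|[|j]] // _.
by rewrite memvZ // cexpS cmulC memv_cprod ?memvf.
Qed.

(** A preimage is found by successive approximation along the powers of the
    algebra: if expm1 u misses c by r in the m-th power, then expm1 (u + r)
    misses it by an element of the next power.  This replaces the logarithm. *)
Lemma expm1_surj (c : N) : exists u, expm1 u = c.
Proof.
suff /(_ (\dim {:N}))[u] m : exists u, c - expm1 u \in cpow N m.
  by rewrite cpow_dim // memv0 subr_eq0 => /eqP ->; exists u.
elim: m => [|m [u uP]]; first by exists 0; rewrite memvf.
have [r cE] : exists r, c = expm1 u + r.
  by exists (c - expm1 u); rewrite addrC subrK.
rewrite cE addrC addKr in uP; exists (u + r).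
rewrite cE expm1D [expm1 r]/(r + exp2 r) addrA -(addrA (_ + r)) opprD addrA.
rewrite subrr sub0r memvN memvD ?exp2_cpow //.
apply: memv_cprod; rewrite ?memvf ?memvD //.
by rewrite (subvP (cpowS_sub _ _)) ?exp2_cpow.
Qed.

End Exponential.

Lemma cexp_morph (K : fieldType) (N N' : calg K) (f : {linear N -> N'}) u m :
  (forall u v, f (cmul u v) = cmul (f u) (f v)) ->
  f (cexp u m) = cexp (f u) m.
Proof.
move=> fM; case: m => [|m]; first by [].
by elim: m => // m IHm; rewrite !cexpS fM IHm.
Qed.

Lemma expm1_morph (K : fieldType) (N N' : calg K) (f : {linear N -> N'}) u :
  nilpotent N -> nilpotent N' ->
  (forall u v, f (cmul u v) = cmul (f u) (f v)) ->
  f (expm1 u) = expm1 (f u).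
Proof.
move=> nilN nilN' fM; rewrite /expm1 linearD; congr (_ + _).
rewrite (exp2E u nilN (leq_maxl _ (\dim {:N'}))).
rewrite (exp2E (f u) nilN' (leq_maxr (\dim {:N}) _)) linear_sum.
by apply: eq_bigr => m _; rewrite linearZ /= cexp_morph.
Qed.

(** * Linear forms that do not vanish on the annihilator *)

Definition mk_linear (K : pzRingType) (V W : lmodType K) (f : V -> W)
    (lin_f : linear f) : {linear V -> W} :=
  HB.pack f (GRing.isLinear.Build K V W *:%R f lin_f).

Section Functionals.
Context {K : fieldType} {N : calg K}.
Implicit Types (omega lambda : 'Hom(N, K^o)) (a c e u v w : N).

(** The ideal generated by w meets the annihilator: as long as w does not
    annihilate everything, replace it by a nonzero multiple, which lies deeper
    in the filtration by powers; nilpotency stops the process. *)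
Lemma nilpotent_socle w : nilpotent N -> w != 0 ->
  exists e, [/\ e \in ann N, e != 0 & e = w \/ exists z, e = cmul w z].
Proof.
move=> [nu nu0]; suff chain j : forall k w, (j + k = nu)%N ->
    w != 0 -> w \in cpow N k ->
    exists e, [/\ e \in ann N, e != 0 & e = w \/ exists z, e = cmul w z].
  by move=> w0; apply: (chain nu 0%N) => //; rewrite ?addn0 ?memvf.
elim: j => [k {}w|j IHj k {}w jk w0 wk].
  by rewrite add0n => -> w0; rewrite nu0 memv0 (negbTE w0).
have [wann|/annP wann] := boolP (w \in ann N).
  by exists w; split => //; left.
have [v wv] : exists v, cmul w v != 0.
  have : lmulv w != 0.
    by apply/eqP => w1; apply: wann => v;
      rewrite -[cmul w v]lfunE -/(lmulv w) w1 lfunE.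
  by move=> /lfunPn[v]; rewrite lfunE zero_lfunE; exists v.
have [||//|e [eann e0 ez]] := IHj k.+1 (cmul w v).
- by rewrite addnS -addSn.
- by [].
- by rewrite cmulC memv_cprod ?memvf.
exists e; split=> //; right.
by case: ez => [->|[z ->]]; [exists v | exists (cmul v z); rewrite cmulA].
Qed.

Lemma ann_gen omega : (omega @: ann N)%VS = fullv ->
  exists2 a, a \in ann N & omega a = 1.
Proof.
move=> full; have : (1 : K^o) \in (omega @: ann N)%VS by rewrite full memvf.
by move=> /memv_imgP[a aann a1]; exists a.
Qed.

Lemma ann_line omega a e : \dim (ann N) = 1%N -> a \in ann N -> omega a = 1 ->
  e \in ann N -> e = omega e *: a.
Proof.
move=> dim1 aann a1; have a0 : a != 0.
  by apply: contra_eq_neq a1 => ->; rewrite linear0 eq_sym oner_neq0.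
have /eqP <- : <[a]>%VS == ann N.
  by rewrite eqEdim dim1 dim_vline a0 -memvE aann.
by move=> /vlineP[k ->]; rewrite linearZ /= a1 [k *: 1]mulr1.
Qed.

(** Otherwise some cv is nonzero, and its multiples, on which omega vanishes,
    contain a nonzero element of the annihilator, on which it does not. *)
Lemma mul_form_nondegenerate omega a c : admissible N -> a \in ann N ->
  omega a = 1 ->
  (forall y, omega (cmul c y) = 0) -> c \in ann N.
Proof.
move=> [nilN dim1] aann a1 c0; apply/annP => v; apply/eqP/negPn/negP => cv0.
have [e [eann e0 ez]] := nilpotent_socle nilN cv0.
have e1 : omega e = 0.
  by case: ez => [->|[z ->]]; rewrite -?cmulA c0.
by move: e0; rewrite (ann_line dim1 aann a1 eann) e1 scale0r eqxx.
Qed.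

(** By dimension: the forms omega(c -) vanish at a, and c |-> omega(c -) has
    kernel the annihilator, a line. *)
Lemma functional_mulP omega a lambda :
  admissible N -> a \in ann N -> omega a = 1 ->
  lambda a = 0 -> exists c, forall x, lambda x = omega (cmul c x).
Proof.
move=> admN aann a1 la0; have [nilN dim1] := admN.
have lin_G : linear (fun c => (omega \o lmulv c)%VF).
  by move=> k u v; rewrite linearP comp_lfunDr comp_lfunZr.
have lin_ev : linear (fun h : 'Hom(N, K^o) => h a).
  by move=> k g h; rewrite add_lfunE scale_lfunE.
pose G := linfun (mk_linear lin_G); pose ev := linfun (mk_linear lin_ev).
(* The image of G and the kernel of the evaluation at a are both hyperplanes. *)
have dimG : (\dim {:N} <= (\dim (limg G)).+1)%N.
  rewrite -(limg_ker_dim G) capfv -add1n leq_add2r -dim1 dimvS //.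
  apply/subvP => c; rewrite memv_ker lfunE /= => /eqP c0.
  apply: (mul_form_nondegenerate admN aann a1) => y.
  by have := congr1 (fun h : 'Hom(N, K^o) => h y) c0; rewrite comp_lfunE !lfunE.
have ev_gt0 : (0 < \dim (limg ev))%N.
  rewrite lt0n dimv_eq0; apply/eqP => ev0.
  have : ev omega \in limg ev by rewrite memv_img ?memvf.
  by rewrite ev0 memv0 lfunE /= a1 oner_eq0.
have subG : (limg G <= lker ev)%VS.
  apply/subvP => _ /memv_imgP[c _ ->]; rewrite memv_ker !lfunE /= comp_lfunE.
  by rewrite lfunE /= cmulC (annP _ aann) linear0.
have /eqP eqG : limg G == lker ev.
  rewrite eqEdim subG /=; have := limg_ker_dim ev fullv; rewrite capfv.
  have -> : \dim {:'Hom(N, K^o)} = \dim {:N} by rewrite !dimvf -[RHS]muln1.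
  by move: dimG ev_gt0; lia.
have : lambda \in limg G by rewrite eqG memv_ker lfunE /= la0.
move=> /memv_imgP[c _ ->]; exists c => x.
by rewrite lfunE /= comp_lfunE lfunE.
Qed.

End Functionals.

(** * Graphs of nil-polynomials as exponential loci *)

Lemma lfun_mk_linear (K : fieldType) (V W : vectType K) (f : V -> W)
  (lin_f : linear f) v : linfun (mk_linear lin_f) v = f v.
Proof. by rewrite lfunE. Qed.

(** The coordinates given by a nil-polynomial, together with the projection
    along the annihilator: v |-> (omega v, psi v) is a linear isomorphism with
    inverse (s, x) |-> phi x + s a. *)
Record chart (K : fieldType) (N : calg K) (n : nat) (omega : 'Hom(N, K^o))
    (phi : 'Hom('cV[K]_n, N)) (psi : 'Hom(N, 'cV[K]_n)) (a : N) : Prop :=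
      Chart {
  chart_ann : a \in ann N;
  chart_form_ann : omega a = 1;
  chart_form_emb : forall x, omega (phi x) = 0;
  chart_embK : cancel phi psi;
  chart_projK : forall v, phi (psi v) = v - (omega v : K) *: a
}.

Lemma nil_polynomial_chart (K : fieldType) (N : calg K) n (P : {mpoly K[n]}) :
  admissible N -> nil_polynomial N P ->
  exists omega phi psi a, @chart K N n omega phi psi a /\
    forall x, mpeval P x = omega (exp2 (phi x)).
Proof.
move=> [_ dim1] [omega [phi [full /eqP ker_phi im_phi PE]]].
have [a aann a1] := ann_gen full.
have lin_pr : linear (fun v : N => phi^-1%VF (v - (omega v : K) *: a)).
  move=> k u v; rewrite -linearP (linearP omega); congr (_ _).
  by rewrite scalerBr scalerDl scalerA opprD addrACA.
exists omega, phi, (linfun (mk_linear lin_pr)), a; split=> //.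
have phi0 x : omega (phi x) = 0.
  by apply/eqP; rewrite -memv_ker -im_phi memv_img ?memvf.
split=> // [x|v]; rewrite lfun_mk_linear.
  by rewrite phi0 scale0r subr0 lker0_lfunK.
rewrite limg_lfunVK // im_phi memv_ker linearB linearZ /= a1 [_ *: 1]mulr1.
by rewrite subrr.
Qed.

Lemma chart_proj_ann (K : fieldType) (N : calg K) n omega phi psi a :
  @chart K N n omega phi psi a -> psi a = 0.
Proof.
move=> ch; rewrite -[LHS](chart_embK ch) (chart_projK ch) (chart_form_ann ch).
by rewrite scale1r subrr linear0.
Qed.

(** The hypersurface omega(exp y - 1) = 0, an intrinsic model of the graph. *)
Definition exp_locus (K : fieldType) (N : calg K) (omega : 'Hom(N, K^o)) :
    set N :=
  fun y => omega (expm1 y) = 0.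

(** Adding an element of the annihilator to y adds the same element to expm1 y,
    so omega (expm1 (phi x - s a)) = P(x) - s. *)
Lemma graph_exp_locus (K : numFieldType) (N : calg K) n (P : {mpoly K[n]})
    omega phi psi a : nilpotent N ->
  @chart K N n omega phi psi a ->
  (forall x, mpeval P x = omega (exp2 (phi x))) ->
  exists (L : {linear (K^o * 'cV[K]_n)%type -> N})
         (L' : {linear N -> (K^o * 'cV[K]_n)%type}),
    [/\ cancel L L', cancel L' L
      & forall p, graph P p <-> exp_locus omega (L p)].
Proof.
move=> nilN ch PE.
have lin_L : linear (fun p : (K^o * 'cV[K]_n)%type => phi p.2 - (p.1 : K) *: a).
  move=> k p q /=; rewrite linearP scalerBr.
  rewrite [(k *: p.1 + q.1 : K^o)]/(k * p.1 + q.1).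
  by rewrite scalerDl -scalerA opprD addrACA.
have lin_L' : linear (fun v : N => (- omega v, psi v) : (K^o * 'cV[K]_n)%type).
  move=> k u v; congr pair; rewrite /= !linearP //.
exists (mk_linear lin_L), (mk_linear lin_L'); split=> [[s x]|v|[s x]] /=.
- rewrite !linearB !linearZ /= (chart_proj_ann ch) (chart_form_emb ch).
  rewrite (chart_form_ann ch) (chart_embK ch) !oppr0 scaler0 addr0 add0r opprK.
  by congr pair; rewrite [_ *: _]mulr1.
- by rewrite (chart_projK ch) scaleNr opprK subrK.
rewrite /exp_locus expm1D_ann ?memvN ?memvZ ?(chart_ann ch) //.
rewrite /graph /= linearB linearD linearZ /= (chart_form_emb ch).
rewrite (chart_form_ann ch) -PE add0r [_ *: 1]mulr1.
by split=> [->|/eqP]; [rewrite subrr | rewrite subr_eq0 => /eqP].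
Qed.

(** Up to a factor s the form w2 is w1(exp d -), so w2(exp y - 1) is
    s w1(exp (y + d) - exp d); a further translation along the annihilator
    absorbs the constant w1(exp d - 1). *)
Lemma exp_locus_translate (K : numFieldType) (N : calg K)
    (w1 w2 : 'Hom(N, K^o)) a1 a2 : admissible N ->
  a1 \in ann N -> w1 a1 = 1 -> a2 \in ann N -> w2 a2 = 1 ->
  exists b, forall y, exp_locus w2 y <-> exp_locus w1 (y + b).
Proof.
move=> admN a1ann w1a a2ann w2a; have [nilN dim1] := admN.
pose s : K := w2 a1.
have s0 : s != 0.
  apply: contra_eq_neq w2a => s0.
  by rewrite (ann_line dim1 a1ann w1a a2ann) linearZ /= -/s s0 scaler0 eq_sym
    oner_neq0.
have [|c cE] := functional_mulP (lambda := s^-1 *: w2 - w1) admN a1ann w1a.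
  by rewrite add_lfunE opp_lfunE scale_lfunE w1a [_ *: _]mulVf // subrr.
(* Now w2 is s times w1(exp d -), and e is what makes the constant vanish. *)
have [d dE] := expm1_surj nilN c.
pose e := (w1 c : K) *: a1.
have eann : e \in ann N by rewrite memvZ.
have w1e : w1 e = w1 c by rewrite linearZ /= w1a [_ *: 1]mulr1.
exists (d - e) => y.
rewrite /exp_locus addrA expm1D_ann ?memvN // (linearB w1) /= w1e.
rewrite expm1D // dE (linearD w1 _ (cmul _ _)) (linearD w1 _ c) /=.
rewrite [cmul _ c]cmulC -cE add_lfunE opp_lfunE scale_lfunE.
rewrite addrAC addrK addrCA subrr addr0.
split=> [->|/eqP]; first by rewrite scaler0.
by rewrite [_ == 0]mulf_eq0 invr_eq0 (negbTE s0) => /eqP.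
Qed.

(** * Affine and linear equivalences of graphs *)

Lemma image_bijP (T U : Type) (f : T -> U) (A : set T) (B : set U) :
  bijective f -> (forall x, A x <-> B (f x)) -> (f @` A)%classic = B.
Proof.
move=> [g fK gK] AB; apply/seteqP; split=> [_ [x Ax <-]|y By]; first exact/AB.
by exists (g y); [apply/AB; rewrite gK | rewrite gK].
Qed.

Lemma affine_iso_comp (K : fieldType) (U V W : lmodType K)
    (f : V -> W) (g : U -> V) :
  affine_iso f -> affine_iso g -> affine_iso (f \o g).
Proof.
move=> [f0 [b [bij_f fE]]] [g0 [c [bij_g gE]]].
exists (f0 \o g0 : {linear U -> W}), (f0 c + b); split; first exact: bij_comp.
by move=> x /=; rewrite fE gE linearD addrA.
Qed.

Lemma graph0 (K : fieldType) (N : calg K) n (P : {mpoly K[n]}) :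
  nil_polynomial N P -> graph P 0.
Proof.
move=> [omega [phi [_ _ _ PE]]]; rewrite /graph /= PE linear0.
by rewrite /exp2 big_nat big1 ?linear0 // => -[|[|m]] // _;
  rewrite cexpS cmul0l scaler0.
Qed.

(** Both graphs pass through the origin; a symmetry of the homogeneous one moves
    the image, or the preimage, of the origin back to the origin. *)
Lemma affine_graph_linear (K : fieldType) (N N' : calg K) n
    (P P' : {mpoly K[n]}) :
  nil_polynomial N P -> nil_polynomial N' P' ->
  aff_homogeneous (graph P) \/ aff_homogeneous (graph P') ->
  aff_equiv (graph P) (graph P') -> lin_equiv (graph P) (graph P').
Proof.
move=> /graph0 P0 /graph0 P'0 hom [f [aff_f fS]].
suff [h [h0 [l [b [bij_l hE]]] hS]] : exists h : (K^o * 'cV[K]_n)%type ->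
  (K^o * 'cV[K]_n)%type,
    [/\ h 0 = 0, affine_iso h & (h @` graph P = graph P')%classic].
  exists l; split=> //; rewrite -hS; congr ((_ @` _)%classic).
  apply/boolp.funext => x; rewrite hE.
  by move: h0; rewrite hE linear0 add0r => ->; rewrite addr0.
case: hom => hom.
  have [p Pp fp] : (f @` graph P)%classic 0 by rewrite fS.
  have [h [aff_h hS h0]] := hom _ _ P0 Pp.
  exists (f \o h); split; [by rewrite /= h0 fp | exact: affine_iso_comp |].
  by rewrite -image_comp hS.
have P'f : graph P' (f 0) by rewrite -fS; exists 0.
have [h [aff_h hS h0]] := hom _ _ P'f P'0.
exists (h \o f); split; [by rewrite /= h0 | exact: affine_iso_comp |].
by rewrite -image_comp fS.
Qed.

(** An isomorphism F commutes with expm1, so F maps the locus of the pulled back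
    form w to the locus in the target; the locus of omega is a translate of
    that of w. *)
Lemma calg_iso_affine (K : numFieldType) (N N' : calg K) n
    (P P' : {mpoly K[n]}) :
  admissible N -> admissible N' ->
  nil_polynomial N P -> nil_polynomial N' P' ->
  calg_iso N N' -> aff_equiv (graph P) (graph P').
Proof.
move=> admN admN' nilP nilP' [F [bijF FM]].
have [omega [phi [psi [a [ch PE]]]]] := nil_polynomial_chart admN nilP.
have [omega' [phi' [psi' [a' [ch' PE']]]]] := nil_polynomial_chart admN' nilP'.
have [L [Li [LK LiK LP]]] := graph_exp_locus admN.1 ch PE.
have [L' [Li' [LK' LiK' LP']]] := graph_exp_locus admN'.1 ch' PE'.
have [G FK GK] := bijF.
pose w := (omega' \o linfun F)%VF.
have Ga_ann : G a' \in ann N.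
  apply/annP => v; apply: (can_inj FK); rewrite FM GK linear0.
  exact: (annP _ (chart_ann ch')).
have wG : w (G a') = 1 by rewrite comp_lfunE lfunE /= GK (chart_form_ann ch').
have [b bP] := exp_locus_translate admN Ga_ann wG (chart_ann ch)
  (chart_form_ann ch).
exists (fun p => (Li' \o F \o L : {linear _ -> _}) p + Li' (F b)); split.
  exists (Li' \o F \o L : {linear _ -> _}), (Li' (F b)); split=> //.
  apply: bij_comp; last by exists Li.
  by apply: bij_comp => //; exists L'.
apply: image_bijP => [|p].
  pose M := fun q => Li (G (L' (q - Li' (F b)))).
  exists M => [p|q]; rewrite /M.
    by rewrite addrK /= LiK' FK LK.
  by rewrite /= LiK GK LK' subrK.
rewrite LP LP' bP /= -linearD -linearD LiK' /exp_locus comp_lfunE lfunE /=.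
by rewrite (expm1_morph _ admN.1 admN'.1 FM).
Qed.

(** * Automorphisms of graded algebras *)

(** Components are indexed by their degrees and extracted by projections pr j
    that are defined for every natural number j, so that degrees can be added
    and subtracted freely. *)
Record grading (K : fieldType) (N : calg K) (G : nat -> {vspace N}) (k : nat)
    (pr : nat -> 'End(N)) : Prop := Grading {
  grading_mul : forall j m u v, (0 < j)%N -> (0 < m)%N ->
    u \in G j -> v \in G m -> cmul u v \in G (j + m)%N;
  grading_gt : forall j, (k < j)%N -> G j = 0%VS;
  grading_mem : forall j v, (0 < j)%N -> pr j v \in G j;
  grading_sum : forall v, v = \sum_(j < k) pr j.+1 v;
  grading_id : forall j v, (0 < j)%N -> v \in G j -> pr j v = v;
  grading_ortho : forall i j v, (0 < j)%N -> i != j -> v \in G j -> pr i v = 0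
}.

Lemma graded_grading (K : fieldType) (N : calg K) :
  graded N -> exists G k pr, @grading K N G k pr.
Proof.
move=> [G [k [Gk Gfull Gdir Gmul]]].
pose pr0 (i : 'I_k) : 'End(N) :=
  sumv_pi_for (erefl (\sum_(j < k) G j.+1)%VS) i.
have pr0_mem i v : pr0 i v \in G i.+1 by exact: memv_sum_pi.
have pr0_sum v : \sum_(i < k) pr0 i v = v.
  by apply: sumv_pi_sum; rewrite Gfull memvf.
have pr0E (i : 'I_k) v : v \in G i.+1 ->
  forall j, pr0 j v = if j == i then v else 0.
  move=> vi j; have /directv_sum_unique uniqG := Gdir.
  have mem_v l : xpredT l -> (if l == i then v else 0) \in G l.+1.
    by move=> _; case: eqP => [->|]; rewrite ?mem0v.
  have := uniqG (pr0^~ v) _ (fun l _ => pr0_mem l v) mem_v.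
  rewrite pr0_sum -big_mkcond big_pred1_eq eqxx.
  by move=> /esym/forallP/(_ j)/eqP.
pose pr j : 'End(N) := if j is j'.+1 then
  (if insub j' is Some i then pr0 i else 0) else 0.
have prS (i : 'I_k) : pr i.+1 = pr0 i by rewrite /pr valK.
have pr_ge i : (k <= i)%N -> pr i.+1 = 0.
  by move=> ki; rewrite /pr insubF // ltnNge ki.
exists G, k, pr; split=> // [[|j] v // _|v|[|j] v // _ vj|i [|j] v // _ ij vj].
- case: (ltnP j k) => jk; last by rewrite pr_ge // zero_lfunE mem0v.
  by rewrite -[j]/(val (Ordinal jk)) prS pr0_mem.
- by rewrite -[LHS]pr0_sum; apply: eq_bigr => i _; rewrite prS.
- case: (ltnP j k) => jk.
    by rewrite -[j]/(val (Ordinal jk)) prS (pr0E (Ordinal jk)) ?eqxx.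
  by move: vj; rewrite Gk // memv0 => /eqP ->; rewrite linear0.
case: i ij => [|l] lj; first by rewrite zero_lfunE.
case: (ltnP l k) => lk; last by rewrite pr_ge // zero_lfunE.
case: (ltnP j k) => jk; last by move: vj; rewrite Gk // memv0 => /eqP ->;
  rewrite linear0.
by rewrite -[l]/(val (Ordinal lk)) prS (pr0E (Ordinal jk)) // ifN.
Qed.

Section Grading.
Context {K : numFieldType} {N : calg K} {G : nat -> {vspace N}} {k : nat}.
Context {pr : nat -> 'End(N)}.
Hypothesis grG : grading G k pr.

Lemma grading_eq (V : vectType K) (f g : 'Hom(N, V)) :
  (forall j v, (0 < j)%N -> v \in G j -> f v = g v) -> f = g.
Proof.
move=> fg; apply/lfunP => v; rewrite (grading_sum grG v) !linear_sum.
by apply: eq_bigr => j _; apply: (fg j.+1) => //; apply: grading_mem grG _ _ _.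
Qed.

(** Multiplication by (1 + u)^j, written without a unit. *)
Definition shift (u : N) (j : nat) (v : N) : N :=
  iter j (fun w => w + cmul u w) v.

Lemma shift_linear u j : linear (shift u j).
Proof.
move=> c v w; rewrite /shift; elim: j => //= j ->.
by rewrite linearP scalerDr /= addrACA.
Qed.

Lemma shift0 u j : shift u j 0 = 0.
Proof. exact: (linear0 (mk_linear (shift_linear u j))). Qed.

Lemma shiftM u i j v w :
  cmul (shift u i v) (shift u j w) = shift u (i + j) (cmul v w).
Proof.
rewrite /shift; elim: i => [|i IHi].
  rewrite add0n /=; elim: j => //= j <-; rewrite cmulDr; congr (_ + _).
  by rewrite !cmulA (cmulC u).
by rewrite addSn /= -IHi cmulDl cmulA.
Qed.

Lemma shift_sqzero u j v : cmul u (cmul u v) = 0 ->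
  shift u j v = v + cmul u v *+ j.
Proof.
move=> uv0; elim: j => [|j IHj]; first by rewrite addr0.
rewrite /shift /= -/(shift u j v) IHj linearD linearMn /= uv0 mul0rn addr0.
by rewrite -addrA -mulrSr.
Qed.

(** In a graded algebra scaling degree j by t^j is an automorphism for every
    scalar t; this is the same construction with the element 1 + u of the
    unitization in place of t. *)
Lemma grading_shift_morph u : exists L : 'End(N),
  (forall v w, L (cmul v w) = cmul (L v) (L w)) /\
  forall j v, (0 < j)%N -> v \in G j -> L v = shift u j v.
Proof.
pose L : 'End(N) :=
  \sum_(j < k) (linfun (mk_linear (shift_linear u j.+1)) \o pr j.+1)%VF.
have LE j v : (0 < j)%N -> v \in G j -> L v = shift u j v.
  case: j => // j _ vj; rewrite sum_lfunE.
  have term i : (linfun (mk_linear (shift_linear u i.+1)) \o pr i.+1)%VF v =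
      if i == j then shift u j.+1 v else 0.
    rewrite comp_lfunE; case: eqP => [->|/eqP ij].
      by rewrite (grading_id grG) // lfunE.
    by rewrite (grading_ortho grG (j := j.+1)) // linear0.
  under eq_bigr do rewrite term.
  case: (ltnP j k) => jk.
    by rewrite (bigD1 (Ordinal jk)) //= eqxx big1 ?addr0 // => i /negbTE;
      rewrite -val_eqE /= => ->.
  move: vj; rewrite (grading_gt grG) // memv0 => /eqP ->.
  by rewrite shift0 big1 // => i _; case: ifP.
exists L; split=> // v w.
have cmul_sum (x y : 'I_k -> N) :
    cmul (\sum_i x i) (\sum_j y j) = \sum_i \sum_j cmul (x i) (y j).
  rewrite cmulC linear_sum; apply: eq_bigr => i _ /=.
  by rewrite cmulC linear_sum.
have L_sum z : L z = \sum_(j < k) L (pr j.+1 z).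
  by rewrite {1}(grading_sum grG z) linear_sum.
rewrite (L_sum v) (L_sum w) cmul_sum {1}(grading_sum grG v).
rewrite {1}(grading_sum grG w) cmul_sum linear_sum.
apply: eq_bigr => i _; rewrite linear_sum; apply: eq_bigr => j _ /=.
have [vi wj] : pr i.+1 v \in G i.+1 /\ pr j.+1 w \in G j.+1.
  by split; apply: (grading_mem grG).
rewrite (LE _ _ _ vi) // (LE _ _ _ wj) // shiftM (LE (i.+1 + j.+1)%N) //.
exact: (grading_mul grG).
Qed.

(** Elements of top degree annihilate everything, for reasons of degree; as the
    annihilator is a line, it is exactly the component of top degree. *)
Lemma grading_top : admissible N -> exists2 d, (0 < d)%N &
  ann N = G d /\ forall j, (d < j)%N -> G j = 0%VS.
Proof.
move=> [nilN dim1].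
have exG : exists j, (0 < j)%N && (G j != 0%VS).
  have [j] : exists j : 'I_k, G j.+1 != 0%VS.
    apply/existsP; apply: contraT => /existsPn G0; move: dim1.
    have -> : ann N = 0%VS.
      apply/eqP; rewrite -subv0; apply/subvP => v _.
      rewrite memv0 (grading_sum grG v) big1 // => j _; apply/eqP.
      have := G0 j; rewrite negbK -memv0 => /eqP <-.
      exact: (grading_mem grG).
    by rewrite dimv0.
  by move=> Gj; exists j.+1.
have ubG j : (0 < j)%N && (G j != 0%VS) -> (j <= k)%N.
  by move=> /andP[_]; apply: contraNT; rewrite -ltnNge => /(grading_gt grG) ->.
case: (ex_maxnP exG ubG) => d /andP[d0 Gd] dmax.
have Ggt j : (d < j)%N -> G j = 0%VS.
  case: j => // j dj; apply/eqP; apply: contraTT dj => Gj.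
  by rewrite -leqNgt dmax.
exists d => //; split=> //; apply/eqP;
  rewrite eq_sym eqEdim dim1 lt0n dimv_eq0 Gd andbT.
apply/subvP => u ud; apply/annP => v;
  rewrite (grading_sum grG v) linear_sum big1 //= => j _.
apply/eqP; rewrite -memv0 -(Ggt (d + j.+1)%N) ?addnS ?ltnS ?leq_addr // -addnS.
by apply: (grading_mul grG) => //; apply: (grading_mem grG).
Qed.

End Grading.

(** A form w that agrees with the homogeneous form w0 on the annihilator is
    corrected degree by degree, from the top degree d down.  If w agrees with
    w0 in degrees above m + 1, then the shift by a suitable u of degree
    d - (m + 1) leaves these degrees alone and changes w in degree m + 1 by
    v |-> (m + 1) w0(uv); every form on that component arises in this way. *)
Lemma graded_normal_form (K : numFieldType) (N : calg K) G k pr d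
    (w0 : 'Hom(N, K^o)) a : admissible N -> @grading K N G k pr ->
  (0 < d)%N -> ann N = G d -> (forall j, (d < j)%N -> G j = 0%VS) ->
  (forall j v, (0 < j)%N -> j != d -> v \in G j -> w0 v = 0) ->
  a \in ann N -> w0 a = 1 ->
  forall w : 'Hom(N, K^o), (forall v, v \in ann N -> w v = w0 v) ->
  exists L : 'End(N), (forall u v, L (cmul u v) = cmul (L u) (L v)) /\
    (w \o L = w0)%VF.
Proof.
move=> admN grG d0 annE Ggt w0E aann w0a.
suff step m : forall w : 'Hom(N, K^o), (forall v, v \in ann N -> w v = w0 v) ->
    (forall j v, (m < j)%N -> v \in G j -> w v = w0 v) ->
    exists L : 'End(N), (forall u v, L (cmul u v) = cmul (L u) (L v)) /\
    (w \o L = w0)%VF.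
  move=> w wann; apply: (step d) => // j v /Ggt ->.
  by rewrite memv0 => /eqP ->; rewrite !linear0.
elim: m => [|m IHm] w wann wE.
  exists \1%VF; split=> [u v|]; first by rewrite !id_lfunE.
  by rewrite comp_lfun1r; apply: (grading_eq grG) => j v; apply: wE.
have [md|dm] := ltnP m.+1 d; last first.
  apply: IHm => // j v; rewrite leq_eqVlt => /orP[/eqP <-|/wE]; last exact.
  move: dm; rewrite leq_eqVlt => /orP[/eqP <-|/Ggt ->].
    by rewrite -annE; apply: wann.
  by rewrite memv0 => /eqP ->; rewrite !linear0.
(* The correction in degree m + 1 is written as w0(c -); only the component of
   c of the complementary degree e contributes, as w0 is homogeneous. *)
pose e := (d - m.+1)%N; have e0 : (0 < e)%N by rewrite subn_gt0.
have ed : (e + m.+1 = d)%N by rewrite subnK // ltnW.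
have [|c cE] := functional_mulP (lambda :=
  ((w0 - w) \o pr m.+1)%VF) admN aann w0a.
  rewrite comp_lfunE (grading_ortho grG (j := d)) ?linear0 -?annE //.
  by rewrite ltn_eqF.
pose u := (m.+1%:R^-1 : K) *: pr e c.
have u_mem : u \in G e by rewrite memvZ // (grading_mem grG).
have uE v : v \in G m.+1 -> w0 v = w v + w0 (cmul u v) *+ m.+1.
  move=> vm; have := cE v.
  rewrite comp_lfunE (grading_id grG) // add_lfunE opp_lfunE => /eqP.
  rewrite subr_eq addrC => /eqP ->; congr (_ + _).
  rewrite cmulZl linearZ /= -scaler_nat scalerA mulfV ?pnatr_eq0 // scale1r.
  rewrite {1}(grading_sum grG c) cmulC linear_sum linear_sum /=.
  have w0_comp j : (0 < j)%N -> j != e -> w0 (cmul v (pr j c)) = 0.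
    move=> j0 je; apply: (w0E (m.+1 + j)%N) => //.
      by apply: contra_neq je => jd; move: ed; rewrite -jd addnC => /addnI.
    by apply: (grading_mul grG) => //; apply: (grading_mem grG).
  have [ek|ke] := ltnP e.-1 k.
    rewrite (bigD1 (Ordinal ek)) //= prednK // big1 ?addr0 1?cmulC // => i ie.
    apply: w0_comp => //; apply: contra_neq ie => ie; apply: val_inj.
    by rewrite /= -ie.
  rewrite big1 => [|i _]; last first.
    apply: w0_comp => //; apply: contraTneq ke => <- /=.
    by rewrite -ltnNge.
  have -> : pr e c = 0.
    have ge : (k < e)%N by move: ke e0; lia.
    by apply/eqP; rewrite -memv0 -(grading_gt grG ge) (grading_mem grG).
  by rewrite cmul0l linear0.
have [L1 [L1M L1E]] := grading_shift_morph grG u.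
have u_top j v : (m.+1 < j)%N -> v \in G j -> cmul u v = 0.
  move=> mj vj; apply/eqP; rewrite -memv0 -(Ggt (e + j)%N).
    by apply: (grading_mul grG) => //; apply: leq_ltn_trans mj.
  by rewrite -ed ltn_add2l.
have u_ann v : v \in G m.+1 -> cmul u v \in ann N.
  by move=> vm; rewrite annE -ed; apply: (grading_mul grG).
have L1_top j v : (m.+1 < j)%N -> v \in G j -> L1 v = v.
  move=> mj vj; rewrite (L1E j) //; last exact: leq_ltn_trans mj.
  have uv0 := u_top j v mj vj.
  by rewrite shift_sqzero uv0 ?cmul0r // mul0rn addr0.
have [||L2 [L2M L2E]] := IHm (w \o L1)%VF.
- by move=> v vann; rewrite comp_lfunE (L1_top d) -?annE // wann.
- move=> j v; rewrite leq_eqVlt comp_lfunE => /orP[/eqP <- vm|mj vj].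
    have /annP uv_ann := u_ann v vm.
    rewrite (L1E m.+1) // shift_sqzero; last by rewrite cmulC.
    by rewrite linearD linearMn /= (wann (cmul u v)) ?u_ann // -uE.
  by rewrite (L1_top j) // (wE j).
exists (L1 \o L2)%VF; split=> [x y|]; last by rewrite comp_lfunA.
by rewrite !comp_lfunE L2M L1M.
Qed.

(** The kernel of L is an ideal on which w0 vanishes, hence it is 0 by
    nondegeneracy. *)
Lemma form_morph_inj (K : fieldType) (N : calg K) (w w0 : 'Hom(N, K^o))
    (L : 'End(N)) a :
  admissible N -> a \in ann N -> w0 a = 1 ->
  (forall u v, L (cmul u v) = cmul (L u) (L v)) -> (w \o L = w0)%VF ->
  lker L == 0%VS.
Proof.
move=> admN aann w0a LM wL; rewrite -subv0; apply/subvP => v.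
rewrite memv_ker memv0 => /eqP Lv.
have w0v y : w0 (cmul v y) = 0 by rewrite -wL comp_lfunE LM Lv cmul0l linear0.
have vann := mul_form_nondegenerate admN aann w0a w0v.
by rewrite (ann_line admN.2 aann w0a vann) -wL comp_lfunE Lv linear0 scale0r.
Qed.

(** Both forms are moved to the homogeneous form that vanishes outside the top
    degree. *)
Lemma graded_transitive (K : numFieldType) (N : calg K)
    (w1 w2 : 'Hom(N, K^o)) a :
  admissible N -> graded N -> a \in ann N -> w1 a = 1 ->
  (forall v, v \in ann N -> w2 v = w1 v) ->
  exists L : 'End(N), [/\ lker L == 0%VS,
    forall u v, L (cmul u v) = cmul (L u) (L v) & (w2 \o L = w1)%VF].
Proof.
move=> admN /graded_grading[G [k [pr grG]]] aann w1a w21.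
have [d d0 [annE Ggt]] := grading_top grG admN.
pose w0 := (w1 \o pr d)%VF.
have w0E j v : (0 < j)%N -> j != d -> v \in G j -> w0 v = 0.
  move=> j0 jd vj; rewrite comp_lfunE (grading_ortho grG (j := j)) ?linear0 //.
  by rewrite eq_sym.
have w01 v : v \in ann N -> w0 v = w1 v.
  by move=> vann; rewrite comp_lfunE (grading_id grG) -?annE.
have w0a : w0 a = 1 by rewrite w01.
have nf := graded_normal_form admN grG d0 annE Ggt w0E aann w0a.
have [|L1 [L1M L1E]] := nf w1; first by move=> v /w01.
have [|L2 [L2M L2E]] := nf w2; first by move=> v vann; rewrite w21 ?w01.
have kerL1 := form_morph_inj admN aann w0a L1M L1E.
have LE : (w2 \o (L2 \o L1^-1) = w1)%VF.
  by rewrite comp_lfunA L2E -L1E -comp_lfunA lker0_compfV // comp_lfun1r.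
have LM u v : (L2 \o L1^-1)%VF (cmul u v) =
    cmul ((L2 \o L1^-1)%VF u) ((L2 \o L1^-1)%VF v).
  rewrite !comp_lfunE -L2M; congr (L2 _).
  have /lker0P injL1 := kerL1; apply: injL1.
  by rewrite L1M !lker0_lfunVK.
exists (L2 \o L1^-1)%VF; split=> //.
exact: form_morph_inj admN aann w1a LM LE.
Qed.

(** Near p the locus is described by the form w(exp p -): for p in the locus,
    w(exp (p + z) - 1) = w(exp p (exp z - 1)).  An automorphism L that takes
    the form at p to the form at q makes y |-> q + L(y - p) a symmetry. *)
Lemma graded_homogeneous (K : numFieldType) (N : calg K) n (P : {mpoly K[n]}) :
  admissible N -> nil_polynomial N P -> graded N -> aff_homogeneous (graph P).
Proof.
move=> admN nilP grN p q Pp Pq; have [nilN dim1] := admN.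
have [w [phi [psi [a [ch PE]]]]] := nil_polynomial_chart admN nilP.
have [L [Li [LK LiK LP]]] := graph_exp_locus nilN ch PE.
have aann := chart_ann ch; have wa := chart_form_ann ch.
(* wt z is the form w(exp z -). *)
pose wt z := (w \o (\1 + lmulv (expm1 z)))%VF : 'Hom(N, K^o).
have wtE z x : wt z x = w x + w (cmul (expm1 z) x).
  by rewrite comp_lfunE add_lfunE id_lfunE lfunE linearD.
have wt_ann z v : v \in ann N -> wt z v = w v.
  by move=> /annP va; rewrite wtE cmulC va linear0 addr0.
have wt_shift z y : w (expm1 (z + y)) = w (expm1 z) + wt z (expm1 y).
  by rewrite expm1D // wtE (linearD w _ (cmul _ _)) (linearD w (expm1 z))
    -addrA.
have [|v va|M [kerM MM ME]] :=
    graded_transitive (w1 := wt (L p)) (w2 := wt (L q)) admN grN aann.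
- by rewrite wt_ann.
- by rewrite !wt_ann.
have Mexp y : M (expm1 y) = expm1 (M y).
  exact: (expm1_morph y nilN nilN MM).
have bijM : bijective M.
  by exists (M^-1)%VF; [exact: lker0_lfunK | exact: lker0_lfunVK].
pose f : {linear (K^o * 'cV[K]_n)%type -> (K^o * 'cV[K]_n)%type} :=
  Li \o M \o L.
have bijf : bijective f.
  by apply: bij_comp; [apply: bij_comp => //; exists L | exists Li].
have fE x : L (f x + (q - f p)) = L q + M (L x - L p).
  by rewrite addrCA -(linearB f) (linearD L) /= LiK (linearB L).
exists (fun x => f x + (q - f p)); split.
- by exists f, (q - f p).
- apply: image_bijP => [|x].
    have [g fK gK] := bijf; exists (fun y => g (y - (q - f p))) => y.
      by rewrite addrK fK.
    by rewrite gK subrK.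
  rewrite !LP /exp_locus fE wt_shift -Mexp -comp_lfunE ME.
  rewrite -{1}(subrK (L p) (L x)) (addrC _ (L p)) wt_shift.
  have /LP -> := Pp; have /LP -> := Pq; by rewrite !add0r.
- by rewrite addrC subrK.
Qed.

(** * Homogeneous components along polynomial curves *)

Lemma poly_ext (K : numFieldType) (p q : {poly K}) :
  (forall t, p.[t] = q.[t]) -> p = q.
Proof.
move=> pq; apply/eqP; rewrite -subr_eq0; apply: contraT => r0.
pose s : seq K := [seq j%:R | j <- iota 0 (size (p - q))].
have := @max_poly_roots _ (p - q) s r0; rewrite size_map size_iota ltnn.
apply; first by apply/allP => _ /mapP[j _ ->]; rewrite rootE !hornerE pq subrr.
by rewrite map_inj_uniq ?iota_uniq // => i j /eqP; rewrite eqr_nat => /eqP.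
Qed.

Section Curves.
Context {K : numFieldType} {n : nat}.
Implicit Types (P : {mpoly K[n]}) (x : 'cV[K]_n) (h : 'I_n -> {poly K}).

Lemma mpeval_hcompZ P l t x :
  mpeval (hcomp l P) (t *: x) = t ^+ l * mpeval (hcomp l P) x.
Proof.
rewrite /mpeval !mevalE mulr_sumr big_seq [RHS]big_seq; apply: eq_bigr => m mP.
have /dhomogP/(_ m mP) <- := pihomogP mdeg l P.
rewrite mulrCA; congr (_ * _); under eq_bigr do rewrite mxE exprMn.
by rewrite big_split /= prodrXr mdegE.
Qed.

Lemma mpeval_hcomp_sum P L x : (msize P <= L)%N ->
  mpeval P x = \sum_(l < L) mpeval (hcomp l P) x.
Proof.
move=> PL; rewrite {1}(pihomog_partitionE (mf := mdeg) PL).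
by rewrite /mpeval raddf_sum.
Qed.

Lemma horner_hcomp P L x t : (msize P <= L)%N ->
  (\poly_(j < L) mpeval (hcomp j P) x).[t] = mpeval P (t *: x).
Proof.
move=> PL; rewrite horner_poly (mpeval_hcomp_sum _ PL).
by apply: eq_bigr => j _; rewrite mpeval_hcompZ mulrC.
Qed.

Lemma hcomp_proportional P P' r x y :
  (forall t, mpeval P (t *: x) = r * mpeval P' (t *: y)) ->
  forall l, mpeval (hcomp l P) x = r * mpeval (hcomp l P') y.
Proof.
move=> PP' l; pose L := maxn l.+1 (maxn (msize P) (msize P')).
have PL : (msize P <= L)%N by rewrite !leq_max leqnn orbT.
have P'L : (msize P' <= L)%N by rewrite !leq_max leqnn !orbT.
have lL : (l < L)%N by rewrite leq_max leqnn.
have := @poly_ext K (\poly_(j < L) mpeval (hcomp j P) x)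
  (r *: \poly_(j < L) mpeval (hcomp j P') y).
move=> /(_ _)/(congr1 (fun p : {poly K} => p`_l)).
rewrite coefZ !coef_poly lL; apply=> t.
by rewrite hornerZ !horner_hcomp.
Qed.

Definition mcurve h P : {poly K} :=
  \sum_(m <- msupp P) P@_m *: \prod_i h i ^+ m i.

Lemma mcurveE h P t : (mcurve h P).[t] = mpeval P (\col_i (h i).[t]).
Proof.
rewrite /mpeval mevalE horner_sum; apply: eq_bigr => m _.
rewrite hornerZ horner_prod; congr (_ * _); apply: eq_bigr => i _.
by rewrite horner_exp mxE.
Qed.

Lemma mcurve_scale h P L : (msize P <= L)%N ->
  mcurve (fun i => h i * 'X) P = \sum_(l < L) mcurve h (hcomp l P) * 'X^l.
Proof.
move=> PL; apply: poly_ext => t; rewrite mcurveE horner_sum.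
rewrite (mpeval_hcomp_sum _ PL); apply: eq_bigr => l _.
rewrite hornerM hornerXn mcurveE mulrC -mpeval_hcompZ; congr mpeval.
by apply/colP => i; rewrite !mxE hornerM hornerX mulrC.
Qed.

(** Expansion at t = 0 of P along the curve t h(t), for P without terms of
    degree below 2. *)
Lemma mcurve_coefs h P :
  (forall x, mpeval (hcomp 0 P) x = 0) ->
    (forall x, mpeval (hcomp 1 P) x = 0) ->
  let p := mcurve (fun i => h i * 'X) P in
  [/\ p`_0 = 0, p`_1 = 0, p`_2 = (mcurve h (hcomp 2 P))`_0
    & p`_3 = (mcurve h (hcomp 2 P))`_1 + (mcurve h (hcomp 3 P))`_0].
Proof.
move=> P0 P1 p.
pose Q l := mcurve h (hcomp l P).
have Q0 : Q 0 = 0 by apply: poly_ext => t; rewrite mcurveE P0 horner0.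
have Q1 : Q 1 = 0 by apply: poly_ext => t; rewrite mcurveE P1 horner0.
have pQ : p = Q 2 * 'X^2 + (Q 3 * 'X^3 + \sum_(l < msize P) Q l.+4 * 'X^(l.+4)).
  rewrite /p (mcurve_scale _ (leq_addl 4 _)) !add4n !big_ord_recl.
  by rewrite -!/(Q _) Q0 Q1 !mul0r !add0r.
have pE j : (j < 4)%N -> p`_j = (if (j < 2)%N then 0 else (Q 2)`_(j - 2)) +
    (if (j < 3)%N then 0 else (Q 3)`_(j - 3)).
  move=> j4; have R0 : (\sum_(l < msize P) Q l.+4 * 'X^(l.+4))`_j = 0.
    rewrite coef_sum big1 // => l _.
    by rewrite coefMXn ifT // (leq_trans j4).
  by rewrite pQ !coefD !coefMXn R0 addr0.
by split; rewrite pE //= ?addr0 ?add0r.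
Qed.

(** Comparison of the terms of degree 1, 2 and 3 in t.  Since P(tx) is t s(t)
    with s(0) = 0, the point t u + P(tx) B is t h(t) with h = u + s B, so that B
    enters for the first time in degree 3, through the quadratic part of P'. *)
Lemma affine_image_coefs P P' (c A : K) (u B : 'cV[K]_n) x :
  (forall x, mpeval (hcomp 0 P) x = 0) ->
    (forall x, mpeval (hcomp 1 P) x = 0) ->
  (forall x, mpeval (hcomp 0 P') x = 0) ->
    (forall x, mpeval (hcomp 1 P') x = 0) ->
  forall b e : K, (forall t, mpeval (hcomp 2 P') (u + t *: B) =
                 mpeval (hcomp 2 P') u + t * b + t ^+ 2 * e) ->
  (forall t, t * c + A * mpeval P (t *: x) =
             mpeval P' (t *: u + mpeval P (t *: x) *: B)) ->
  [/\ c = 0,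
      A * mpeval (hcomp 2 P) x = mpeval (hcomp 2 P') u
    & A * mpeval (hcomp 3 P) x =
      mpeval (hcomp 3 P') u + b * mpeval (hcomp 2 P) x].
Proof.
move=> P0 P1 P'0 P'1 b e q2E PP'.
pose hx i : {poly K} := (x i 0)%:P; pose p := mcurve (fun i => hx i * 'X) P.
have pE t : p.[t] = mpeval P (t *: x).
  rewrite mcurveE; congr mpeval; apply/colP => i.
  by rewrite !mxE hornerM hornerX hornerC mulrC.
have := mcurve_coefs hx P0 P1; rewrite -/p => -[p0 p1 p2 p3].
have hxE l : mcurve hx (hcomp l P) = (mpeval (hcomp l P) x)%:P.
  apply: poly_ext => t; rewrite mcurveE hornerC; congr mpeval.
  by apply/colP => i; rewrite mxE hornerC.
rewrite !hxE !coefC /= add0r in p2 p3.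
pose s : {poly K} := \poly_(j < size p) p`_j.+1.
have sE : p = s * 'X.
  apply/polyP => j; rewrite coefMX coef_poly; case: j => [|j] //=.
  by case: ltnP => // pj; rewrite nth_default // ltnW.
pose h i : {poly K} := (u i 0)%:P + (B i 0) *: s.
have PP'_poly : c *: 'X + A *: p = mcurve (fun i => h i * 'X) P'.
  apply: poly_ext => t; rewrite !hornerE mulrC pE PP' mcurveE; congr mpeval.
  apply/colP => i; rewrite !mxE /h hornerM hornerX hornerD hornerC hornerZ.
  by rewrite -pE sE hornerM hornerX; ring.
have [r0 r1 r2 r3] := mcurve_coefs h P'0 P'1.
have s0 : s.[0] = 0 by rewrite horner_coef0 coef_poly p1 if_same.
have s1 : s`_1 = mpeval (hcomp 2 P) x by rewrite -p2 sE coefMX.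
have h2 : mcurve h (hcomp 2 P') =
  (mpeval (hcomp 2 P') u)%:P + b *: s + e *: s ^+ 2.
  apply: poly_ext => t; rewrite mcurveE 2!hornerD !hornerZ hornerC horner_exp.
  rewrite (mulrC b) (mulrC e) -q2E; congr mpeval; apply/colP => i.
  by rewrite !mxE /h !hornerE mulrC.
have h3 : (mcurve h (hcomp 3 P'))`_0 = mpeval (hcomp 3 P') u.
  rewrite -horner_coef0 mcurveE; congr mpeval; apply/colP => i.
  by rewrite mxE /h !hornerE s0 mulr0 addr0.
move: r1 r2 r3; rewrite -PP'_poly !coefD !coefZ !coefX p1 p2 p3 /= h3 h2.
rewrite !coefD !coefC !coefZ /= !mulr1 !mulr0 ?addr0 ?add0r.
have -> : s`_0 = 0 by rewrite -horner_coef0.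
have s20 : (s ^+ 2)`_0 = 0 by rewrite -horner_coef0 horner_exp s0 expr0n.
have s21 : (s ^+ 2)`_1 = 0.
  by rewrite expr2 coefM !big_ord_recl big_ord0 /= -horner_coef0 s0 !mul0r
    mulr0 !addr0.
by rewrite s20 s21 s1 !mulr0 !addr0 => -> -> ->; split=> //; rewrite addrC.
Qed.

End Curves.

(** * Traces of nilpotent operators and polarization *)

(** The matrix X - A divides X^k - A^k = X^k, so the characteristic polynomial
    divides a power of X. *)
Lemma mxtrace_nilpotent (F : fieldType) n (A : 'M[F]_n.+1) k :
  A ^+ k = 0 -> \tr A = 0.
Proof.
move=> Ak0; pose Ac := map_mx polyC A.
have dvdX : char_poly A %| 'X^(k * n.+1).
  have XAk : 'X%:M ^+ k - Ac ^+ k = ('X^k)%:M.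
    have -> : Ac ^+ k = map_mx polyC (A ^+ k) by rewrite rmorphXn.
    by rewrite Ak0 map_mx0 subr0 rmorphXn.
  have := congr1 determinant XAk; rewrite det_scalar -exprM => <-.
  rewrite subrXX_comm; last exact: comm_scalar_mx.
  by rewrite -[_ * _]/(_ *m _) det_mulmx dvdp_mulr.
have /dvdp_exp_XsubCP[j _] : char_poly A %| ('X - 0%:P) ^+ (k * n.+1).
  by rewrite subr0.
rewrite subr0 eqp_monic ?char_poly_monic ?monicXn // => /eqP cpE.
have jE : j = n.+1.
  by have := size_char_poly A; rewrite cpE size_polyXn => -[].
apply: oppr_inj; rewrite -char_poly_trace // cpE jE coefXn oppr0.
by rewrite ltn_eqF.
Qed.

Definition col_matrix (F : fieldType) n (f : 'cV[F]_n -> 'cV[F]_n) : 'M[F]_n :=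
  \matrix_(i, j) f (delta_mx j 0) i 0.

Lemma mul_col_matrix (F : fieldType) n (f : {linear 'cV[F]_n -> 'cV[F]_n}) y :
  col_matrix f *m y = f y.
Proof.
rewrite {2}[y]matrix_sum_delta linear_sum.
apply/colP => i; rewrite !mxE summxE; apply: eq_bigr => j _.
by rewrite big_ord1 linearZ !mxE mulrC.
Qed.

Lemma trace_nilpotent (F : fieldType) n (f : {linear 'cV[F]_n -> 'cV[F]_n}) k :
  (forall y, iter k f y = 0) -> \sum_i f (delta_mx i 0) i 0 = 0.
Proof.
case: n f => [|n] f fk0; first by rewrite big_ord0.
have Ak y : col_matrix f ^+ k *m y = iter k f y.
  elim: k {fk0} => [|k IHk]; first by rewrite expr0 mul1mx.
  by rewrite exprS /= -IHk -mul_col_matrix mulmxA.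
transitivity (\tr (col_matrix f)); first by apply: eq_bigr => i _; rewrite mxE.
apply: (mxtrace_nilpotent (k := k)); apply/matrixP => i j.
have := congr1 (fun v : 'cV_n.+1 => v i 0) (Ak (delta_mx j 0)).
by rewrite fk0 -colE !mxE.
Qed.

Section Polarization.
Context {K : numFieldType} {V : zmodType}.

Lemma polarization2 (F : V -> V -> K) :
  (forall x y, F x y = F y x) -> (forall x y z, F (x + y) z = F x z + F y z) ->
  (forall x, F x x = 0) -> forall x y, F x y = 0.
Proof.
move=> symF addF F0 x y; have := F0 (x + y).
rewrite addF (symF x) (symF y (x + y)) !addF !F0 addr0 add0r (symF y x) -mulr2n.
by move/eqP; rewrite mulrn_eq0 => /eqP.
Qed.

(** Evaluating T on the diagonal at x + y and x - y isolates T x x y, which is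
    quadratic in x. *)
Lemma polarization3 (T : V -> V -> V -> K) :
  (forall x y z, T x y z = T y x z) -> (forall x y z, T x y z = T x z y) ->
  (forall x x' y z, T (x + x') y z = T x y z + T x' y z) ->
  (forall x, T x x x = 0) -> forall x y z, T x y z = 0.
Proof.
move=> sym12 sym23 addT T0.
have T0r x z : T 0 x z = 0.
  by have := addT 0 0 x z; rewrite addr0 -{1}[T 0 x z]addr0 => /addrI <-.
have oppT x y z : T (- x) y z = - T x y z.
  by apply/eqP; rewrite -addr_eq0 -addT addNr T0r.
have Txxy x y : T x x y = 0.
  have cube u v : T (u + v) (u + v) (u + v) =
    T u u u + T u u v *+ 3 + T u v v *+ 3 + T v v v.
    have addT2 a b c d : T a (b + c) d = T a b d + T a c d.
      by rewrite sym12 addT !(sym12 a).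
    have addT3 a b c d : T a b (c + d) = T a b c + T a b d.
      by rewrite sym23 addT2 !(sym23 a b).
    rewrite !(addT, addT2, addT3) (sym12 v u u) (sym23 u v u) (sym12 v u v).
    rewrite (sym23 v v u) (sym12 v u v); ring.
  have := cube x y; have := cube x (- y); rewrite !T0 ?sub0r ?addr0 ?add0r.
  have -> : T x x (- y) = - T x x y by rewrite (sym23 x x) (sym12 x) oppT
    (sym12 y) (sym23 x y).
  have -> : T x (- y) (- y) = T x y y.
    by rewrite (sym12 x) oppT (sym12 y) (sym23 x y) (sym12 x) oppT opprK sym12.
  move=> e1 e2; have /eqP : T x x y *+ 6 = 0.
    transitivity ((T x x y *+ 3 + T x y y *+ 3) - (- T x x y *+ 3 +
      T x y y *+ 3)).
      ring.
    by rewrite -e1 -e2 subrr.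
  by rewrite mulrn_eq0 => /eqP.
move=> x y z; rewrite sym12.
apply: (polarization2 (F := fun x z => T y x z)) => [u v|u v w|u].
- exact: sym23.
- by rewrite sym12 addT !(sym12 y).
by rewrite sym12 sym23 Txxy.
Qed.

End Polarization.

(** * The quadratic and cubic forms of a nil-polynomial *)

Section Forms.
Context {K : numFieldType} {N : calg K} {n : nat} {P : {mpoly K[n]}}.
Context {omega : 'Hom(N, K^o)} {phi : 'Hom('cV[K]_n, N)}.
Context {psi : 'Hom(N, 'cV[K]_n)} {a : N}.
Hypothesis admN : admissible N.
Hypothesis ch : chart omega phi psi a.
Hypothesis PE : forall x, mpeval P x = omega (exp2 (phi x)).

Let nilN : nilpotent N := admN.1.

Lemma cexpZ t (u : N) m : (0 < m)%N -> cexp (t *: u) m = t ^+ m *: cexp u m.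
Proof.
case: m => // m _; elim: m => [|m IHm]; first by rewrite expr1.
by rewrite !cexpS IHm cmulZl cmulZr scalerA -exprS.
Qed.

(** On each line t |-> t x both P and omega \o exp2 \o phi are polynomials in t,
    whose coefficients can be compared. *)
Lemma nil_hcomp l x : mpeval (hcomp l P) x =
  if (l < 2)%N then 0 else l`!%:R^-1 * omega (cexp (phi x) l).
Proof.
pose L := (msize P + l.+1)%N; pose M := maxn (\dim {:N}) l.
pose F j : K := if (j < 2)%N then 0 else j`!%:R^-1 * omega (cexp (phi x) j).
suff pq : \poly_(j < L) mpeval (hcomp j P) x = \poly_(j < M.+1) F j.
  have := congr1 (fun p : {poly K} => p`_l) pq.
  by rewrite !coef_poly ltnS leq_maxr /L addnS ltnS leq_addl.
apply: poly_ext => t; rewrite horner_hcomp ?leq_addr // horner_poly.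
rewrite PE (exp2E _ nilN (leq_maxl _ l)) big_geq_mkord big_mkcond linear_sum.
apply: eq_bigr => j _; rewrite /F /= leqNgt; case: ltnP => j2 /=.
  by rewrite linear0 mul0r.
rewrite !linearZ /= cexpZ; last exact: ltnW.
rewrite linearZ -[RHS]mulrA; congr (_ * _); exact: mulrC.
Qed.

Definition form2 x y : K := omega (cmul (phi x) (phi y)).
Definition form3 x y z : K := omega (cmul (phi x) (cmul (phi y) (phi z))).

Lemma hcomp0 x : mpeval (hcomp 0 P) x = 0.
Proof. by rewrite nil_hcomp. Qed.

Lemma hcomp1 x : mpeval (hcomp 1 P) x = 0.
Proof. by rewrite nil_hcomp. Qed.

Lemma hcomp2 x : mpeval (hcomp 2 P) x = 2%:R^-1 * form2 x x.
Proof. by rewrite nil_hcomp. Qed.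

Lemma hcomp3 x : mpeval (hcomp 3 P) x = 6%:R^-1 * form3 x x x.
Proof. by rewrite nil_hcomp. Qed.

Lemma form2C x y : form2 x y = form2 y x.
Proof. by rewrite /form2 cmulC. Qed.

Lemma form2D x y z : form2 (x + y) z = form2 x z + form2 y z.
Proof. by rewrite /form2 linearD cmulDl linearD. Qed.

Lemma form2Z t x y : form2 (t *: x) y = t * form2 x y.
Proof. by rewrite /form2 linearZ cmulZl linearZ. Qed.

Lemma form2Dr x y z : form2 z (x + y) = form2 z x + form2 z y.
Proof. by rewrite !(form2C z) form2D. Qed.

Lemma form2Zr t x y : form2 x (t *: y) = t * form2 x y.
Proof. by rewrite !(form2C x) form2Z. Qed.

Lemma form3C12 x y z : form3 x y z = form3 y x z.
Proof. by rewrite /form3 !cmulA (cmulC (phi x)). Qed.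

Lemma form3C23 x y z : form3 x y z = form3 x z y.
Proof. by rewrite /form3 (cmulC (phi y)). Qed.

Lemma form3D x x' y z : form3 (x + x') y z = form3 x y z + form3 x' y z.
Proof. by rewrite /form3 linearD cmulDl linearD. Qed.

(** The projection changes v only by an element of the annihilator. *)
Lemma cmul_emb_proj (u v : N) : cmul u (phi (psi v)) = cmul u v.
Proof.
rewrite (chart_projK ch) linearB linearZ /= (cmulC u a).
by rewrite (annP _ (chart_ann ch)) scaler0 subr0.
Qed.

Lemma form2_nondegenerate y : (forall z, form2 y z = 0) -> y = 0.
Proof.
move=> y0; rewrite -(chart_embK ch y).
have yann : phi y \in ann N.
  apply: (mul_form_nondegenerate admN (chart_ann ch) (chart_form_ann ch)) => v.
  by rewrite -cmul_emb_proj; apply: y0.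
rewrite (ann_line admN.2 (chart_ann ch) (chart_form_ann ch) yann).
by rewrite (chart_form_emb ch) scale0r linear0.
Qed.

Lemma form2_inj x y : (forall z, form2 x z = form2 y z) -> x = y.
Proof.
move=> xy; apply/eqP; rewrite -subr_eq0; apply/eqP.
apply: form2_nondegenerate => z.
by rewrite -scaleN1r form2D form2Z xy mulN1r subrr.
Qed.

(** Multiplication by phi x, compressed to the coordinate space: the operator
    that represents the cubic form with respect to the quadratic form. *)
Definition mul_op x y : 'cV[K]_n := psi (cmul (phi x) (phi y)).

Lemma mul_op_linear x : linear (mul_op x).
Proof. by move=> t y z; rewrite /mul_op !linearP. Qed.

Lemma form2_mul_op x y z : form2 (mul_op x y) z = form3 x y z.
Proof. by rewrite /form2 /mul_op cmulC cmul_emb_proj cmulC -cmulA. Qed.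

Lemma mul_op_nilp x y : iter (\dim {:N}) (mul_op x) y = 0.
Proof.
rewrite -(chart_embK ch y).
have -> k v : iter k (mul_op x) (psi v) = psi (iter k (cmul (phi x)) v).
  by elim: k => //= k ->; rewrite /mul_op cmul_emb_proj.
suff : iter (\dim {:N}) (cmul (phi x)) (phi y) \in cpow N (\dim {:N}).
  by rewrite cpow_dim // memv0 => /eqP ->; rewrite linear0.
elim: (\dim _) => [|k IHk]; first exact: memvf.
by apply: memv_cprod => //; apply: memvf.
Qed.

End Forms.

Arguments form2 {K N n} omega phi x y.
Arguments form3 {K N n} omega phi x y z.
Arguments mul_op {K N n} phi psi x y.

(** * Algebras with the same quadratic and cubic forms *)

Section Comparison.
Context {K : numFieldType} {N N' : calg K} {n : nat} {P P' : {mpoly K[n]}}.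
Context {omega : 'Hom(N, K^o)} {phi : 'Hom('cV[K]_n, N)}.
Context {psi : 'Hom(N, 'cV[K]_n)} {a : N}.
Context {omega' : 'Hom(N', K^o)} {phi' : 'Hom('cV[K]_n, N')}.
Context {psi' : 'Hom(N', 'cV[K]_n)} {a' : N'}.
Hypothesis admN : admissible N.
Hypothesis admN' : admissible N'.
Hypothesis ch : chart omega phi psi a.
Hypothesis ch' : chart omega' phi' psi' a'.
Hypothesis PE : forall x, mpeval P x = omega (exp2 (phi x)).
Hypothesis PE' : forall x, mpeval P' x = omega' (exp2 (phi' x)).

Lemma form2_polarize (g : {linear 'cV[K]_n -> 'cV[K]_n}) A :
  (forall x, A * mpeval (hcomp 2 P) x = mpeval (hcomp 2 P') (g x)) ->
  forall x y, A * form2 omega phi x y = form2 omega' phi' (g x) (g y).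
Proof.
move=> q2E x y; apply/eqP; rewrite -subr_eq0; apply/eqP; move: x y.
apply: polarization2 => [x y|x y z|x].
- by rewrite (form2C x) (form2C (g x)).
- by rewrite linearD !form2D; ring.
have := q2E x; rewrite (hcomp2 admN PE) (hcomp2 admN' PE') mulrCA => /mulfI ->.
  by rewrite subrr.
by rewrite invr_eq0 pnatr_eq0.
Qed.

Lemma form3_polarize (g : {linear 'cV[K]_n -> 'cV[K]_n}) A
    (l : {linear 'cV[K]_n -> K^o}) :
  (forall x, A * mpeval (hcomp 3 P) x =
    mpeval (hcomp 3 P') (g x) + (l x : K) * mpeval (hcomp 2 P) x) ->
  forall x y z, A * form3 omega phi x y z =
    form3 omega' phi' (g x) (g y) (g z) +
    ((l x : K) * form2 omega phi y z + (l y : K) * form2 omega phi x z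
     + (l z : K) * form2 omega phi x y).
Proof.
move=> q3E x y z; apply/eqP; rewrite -subr_eq0; apply/eqP; move: x y z.
apply: polarization3 => [x y z|x y z|x x' y z|x].
- rewrite (form3C12 x) (form3C12 (g x)) (form2C x y); ring.
- rewrite (form3C23 x) (form3C23 (g x)) (form2C y z); ring.
- rewrite !linearD !form3D !form2D; ring.
have := q3E x; rewrite (hcomp3 admN PE) (hcomp3 admN' PE') (hcomp2 admN PE).
move=> q; have -> : form3 omega phi x x x =
  6%:R * (6%:R^-1 * form3 omega phi x x x).
  by rewrite mulVKf // pnatr_eq0.
by rewrite mulrCA q; field.
Qed.

(** The isomorphism is g in the coordinate directions and the scaling by c^-1
    between the annihilators.  It preserves omega(u), omega(uv) and omega(uvw)
    up to c, so the defect of multiplicativity is orthogonal to the whole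
    algebra and has omega equal to 0, hence vanishes. *)
Lemma calg_iso_forms (g : 'cV[K]_n -> 'cV[K]_n) (c : K) :
  linear g -> bijective g -> c != 0 ->
  (forall x y, form2 omega phi x y = c * form2 omega' phi' (g x) (g y)) ->
  (forall x y z, form3 omega phi x y z =
    c * form3 omega' phi' (g x) (g y) (g z)) ->
  calg_iso N N'.
Proof.
move=> lin_g [gi gK giK] c0 f2 f3.
have lin_f : linear (fun v => phi' (g (psi v)) + (c^-1 * omega v : K) *: a').
  move=> t u v; rewrite linearP lin_g linearP scalerDr addrACA; congr (_ + _).
  rewrite scalerA -scalerDl linearP mulrDr /=.
  by rewrite [(t *: omega u)%R]/(t * omega u) mulrCA.
pose f := mk_linear lin_f.
have fE v : f v = phi' (g (psi v)) + (c^-1 * omega v : K) *: a' by [].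
have a'ann v : cmul a' v = 0 by exact: (annP _ (chart_ann ch')).
have f_mul u v : cmul (f u) v = cmul (phi' (g (psi u))) v.
  by rewrite fE cmulDl cmulZl a'ann scaler0 addr0.
have emb_mul u v : cmul (phi (psi u)) v = cmul u v.
  by rewrite cmulC (cmul_emb_proj ch) cmulC.
have w'f v : c * omega' (f v) = omega v.
  rewrite fE linearD linearZ /= (chart_form_emb ch') (chart_form_ann ch') add0r.
  by rewrite [_ *: 1]mulr1 mulVKf.
have w'f2 u v : c * omega' (cmul (f u) (f v)) = omega (cmul u v).
  rewrite f_mul cmulC f_mul cmulC -[omega' _]/(form2 omega' phi' _ _) -f2.
  by rewrite /form2 emb_mul (cmul_emb_proj ch).
have w'f3 u v w : c * omega' (cmul (f u) (cmul (f v) (f w))) =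
  omega (cmul u (cmul v w)).
  rewrite f_mul f_mul (cmulC _ (f w)) f_mul (cmulC _ (phi' (g (psi v)))).
  rewrite -[omega' _]/(form3 omega' phi' _ _ _) -f3.
  by rewrite /form3 !emb_mul (cmul_emb_proj ch).
have [h hE] : exists h : N' -> N,
    forall v, h v = phi (gi (psi' v)) + (c * omega' v : K) *: a by eexists.
have g0 : g 0 = 0 by exact: (linear0 (mk_linear lin_g)).
have fK : cancel f h.
  move=> v; rewrite hE w'f fE linearD linearZ /= (chart_proj_ann ch').
  by rewrite scaler0 addr0 (chart_embK ch') gK (chart_projK ch) subrK.
have hK : cancel h f.
  move=> v; rewrite fE hE !linearD !linearZ /= (chart_proj_ann ch).
  rewrite (chart_embK ch) scaler0 addr0 giK (chart_form_emb ch).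
  rewrite (chart_form_ann ch) add0r.
  by rewrite [_ *: 1]mulr1 mulKf // (chart_projK ch') subrK.
exists f; split; first by exists h.
move=> u v; apply/eqP; rewrite -subr_eq0; apply/eqP.
set d := _ - _.
have cI := mulfI c0.
have w'd : omega' d = 0.
  by apply: cI; rewrite mulr0 linearB mulrBr w'f w'f2 subrr.
have dann : d \in ann N'.
  apply: (mul_form_nondegenerate admN' (chart_ann ch') (chart_form_ann ch'))
    => y.
  apply: cI; rewrite mulr0 (cmulC d) -(hK y) linearB linearB mulrBr /=.
  by rewrite w'f2 w'f3 subrr.
by rewrite (ann_line admN'.2 (chart_ann ch') (chart_form_ann ch') dann) w'd
  scale0r.
Qed.

(** With l(x) = form2' (g x) B, polarization gives
    A T(x,y,z) = T'(gx,gy,gz) + l(x) b(y,z) + l(y) b(x,z) + l(z) b(x,y)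
    for the cubic forms T, T' and the quadratic form b.  For fixed x, read as
    bilinear forms in y and z and turned into operators by means of b, the
    terms with T and T' are nilpotent and have trace 0, while the three others
    have traces n l(x), l(x) and l(x).  Hence (n + 2) l(x) = 0. *)
Lemma shear_eq0 (g gi : {linear 'cV[K]_n -> 'cV[K]_n}) (A : K) (B : 'cV[K]_n) :
  cancel g gi -> cancel gi g -> A != 0 ->
  (forall x, A * mpeval (hcomp 2 P) x = mpeval (hcomp 2 P') (g x)) ->
  (forall x, A * mpeval (hcomp 3 P) x = mpeval (hcomp 3 P') (g x) +
     form2 omega' phi' (g x) B * mpeval (hcomp 2 P) x) ->
  B = 0.
Proof.
move=> gK giK A0 q2E q3E.
have f2E := form2_polarize q2E.
have lin_l : linear (fun x => form2 omega' phi' (g x) B : K^o).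
  by move=> t x y; rewrite linearP form2D form2Z.
pose l := mk_linear lin_l.
have f3E := form3_polarize (l := l) q3E.
(* L represents l with respect to the quadratic form. *)
have [L lE] : exists L, forall z, form2 omega phi L z = l z.
  by exists (A *: gi B) => z; rewrite form2Z form2C f2E giK.
pose al x := mk_linear (mul_op_linear (phi := phi) (psi := psi) x).
pose be x : {linear 'cV[K]_n -> 'cV[K]_n} :=
  gi \o mk_linear (mul_op_linear (phi := phi') (psi := psi') (g x)) \o g.
have opE (x y : 'cV[K]_n) : A *: (al x y : 'cV[K]_n) =
  (A *: (be x y : 'cV[K]_n) +
    (l x : K) *: y + (l y : K) *: x + form2 omega phi x y *: L : 'cV[K]_n).
  apply: (form2_inj admN ch) => z.
  rewrite !form2D !form2Z (form2_mul_op ch) lE.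
  have -> : A * form2 omega phi (be x y) z =
    form3 omega' phi' (g x) (g y) (g z).
    by rewrite f2E /= giK (form2_mul_op ch').
  rewrite f3E; ring.
have tr_al x : \sum_i al x (delta_mx i 0) i 0 = 0.
  by apply: (trace_nilpotent (k := \dim {:N})) => y;
    apply: (mul_op_nilp admN ch).
have tr_be x : \sum_i be x (delta_mx i 0) i 0 = 0.
  apply: (trace_nilpotent (k := \dim {:N'})) => y.
  have -> k : iter k (be x) y = gi (iter k (mul_op phi' psi' (g x)) (g y)).
    by elim: k => [|k /= ->]; rewrite /= ?gK ?giK.
  by rewrite (mul_op_nilp admN' ch') linear0.
have functionalE (h : {linear 'cV[K]_n -> K^o}) (x : 'cV[K]_n) :
    \sum_i (h (delta_mx i 0) : K) * x i 0 = h x.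
  rewrite {2}[x]matrix_sum_delta linear_sum; apply: eq_bigr => i _.
  by rewrite big_ord1 linearZ; apply: mulrC.
have l0 (x : 'cV[K]_n) : (l x : K) = 0.
  have lin_x : linear (fun y => form2 omega phi x y : K^o).
    by move=> t y z; rewrite form2Dr form2Zr.
  have : \sum_i (A *: al x (delta_mx i 0)) i 0 = 0.
    under eq_bigr do rewrite mxE.
    by rewrite -mulr_sumr tr_al mulr0.
  under eq_bigr => i _ do rewrite opE !mxE !eqxx mulr1.
  rewrite !big_split /= -mulr_sumr tr_be mulr0 add0r sumr_const card_ord.
  rewrite (functionalE l) (functionalE (mk_linear lin_x)) /= (form2C x L) lE /=
    => /eqP.
  by rewrite -!mulrSr mulrn_eq0 => /eqP.
apply: (form2_nondegenerate admN' ch') => z.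
by rewrite form2C -(giK z); apply: l0.
Qed.

End Comparison.

(** * The equivalences *)

Lemma calg_iso_sym (K : fieldType) (N N' : calg K) :
  calg_iso N N' -> calg_iso N' N.
Proof.
move=> [f [[g fK gK] fM]].
exists (mk_linear (can2_linear fK gK)); split; first by exists f.
by move=> u v; apply: (can_inj fK); rewrite /= fM !gK.
Qed.

Lemma col_matrix_unit (F : fieldType) n (f g : {linear 'cV[F]_n -> 'cV[F]_n}) :
  cancel f g -> col_matrix g \in unitmx.
Proof.
move=> fK; apply: (proj1 (mulmx1_unit (B := col_matrix f) _)).
have AE (y : 'cV_n) : col_matrix g *m col_matrix f *m y = y.
  by rewrite -mulmxA !mul_col_matrix fK.
move: (_ *m _) AE => A AE; apply/matrixP => i j.
have := congr1 (fun v : 'cV_n => v i 0) (AE (delta_mx j 0)).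
by rewrite -colE !mxE eqxx andbT.
Qed.

(** The degree 1 terms of the equation of the image show that f preserves the
    tangent hyperplane; it remains to exclude a shear by B along it. *)
Lemma graph_linear_poly (K : numFieldType) (N N' : calg K) n
    (P P' : {mpoly K[n]}) : admissible N -> admissible N' ->
  nil_polynomial N P -> nil_polynomial N' P' ->
  lin_equiv (graph P) (graph P') -> lin_equiv_poly P P'.
Proof.
move=> admN admN' nilP nilP' [f [[fi fK fiK] fS]].
have [omega [phi [psi [a [ch PE]]]]] := nil_polynomial_chart admN nilP.
have [omega' [phi' [psi' [a' [ch' PE']]]]] := nil_polynomial_chart admN' nilP'.
have [p0 [p1 [p0' p1']]] := (hcomp0 admN PE, (hcomp1 admN PE,
  (hcomp0 admN' PE', hcomp1 admN' PE'))).
pose A : K := (f (1, 0)).1; pose B : 'cV[K]_n := (f (1, 0)).2.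
have lin_in : linear (fun x : 'cV[K]_n => (0, x) : K^o * 'cV[K]_n).
  by move=> t x y; congr pair; rewrite /= scaler0 addr0.
pose j := mk_linear lin_in.
have lin_fst : linear (fun p : K^o * 'cV[K]_n => p.1) by [].
have lin_snd : linear (fun p : K^o * 'cV[K]_n => p.2) by [].
pose c : {linear 'cV[K]_n -> K^o} := mk_linear lin_fst \o f \o j.
pose g : {linear 'cV[K]_n -> 'cV[K]_n} := mk_linear lin_snd \o f \o j.
have fE (s : K) x : f (s, x) = ((c x : K) + s * A, g x + s *: B).
  have -> : (s, x) = j x + s *: (1, 0) :> (K^o * 'cV[K]_n)%type.
    congr pair; first by rewrite /= add0r [_ *: 1]mulr1.
    by rewrite /= scaler0 addr0.
  by rewrite linearD linearZ /=; congr pair.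
have key x : (c x : K) + mpeval P x * A = mpeval P' (g x + mpeval P x *: B).
  have : graph P' (f (mpeval P x, x)) by rewrite -fS; exists (mpeval P x, x).
  by rewrite fE.
have coefs x := @affine_image_coefs K n P P' (c x) A (g x) B x p0 p1 p0' p1'
  (form2 omega' phi' (g x) B) (2%:R^-1 * form2 omega' phi' B B).
have {}coefs x : [/\ (c x : K) = 0,
    A * mpeval (hcomp 2 P) x = mpeval (hcomp 2 P') (g x)
  & A * mpeval (hcomp 3 P) x = mpeval (hcomp 3 P') (g x) +
      form2 omega' phi' (g x) B * mpeval (hcomp 2 P) x].
  apply: coefs => t; last first.
    have cZ : c (t *: x) = t *: c x by rewrite linearZ.
    have gZ : g (t *: x) = t *: g x by rewrite linearZ.
    by rewrite -gZ -key cZ [A * _]mulrC.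
  rewrite !(hcomp2 admN' PE') !form2D !form2Dr !form2Z !form2Zr (form2C B).
  by field.
have c0 x : (c x : K) = 0 by have [] := coefs x.
have q2E x : A * mpeval (hcomp 2 P) x = mpeval (hcomp 2 P') (g x).
  by have [] := coefs x.
have q3E x : A * mpeval (hcomp 3 P) x = mpeval (hcomp 3 P') (g x) +
    form2 omega' phi' (g x) B * mpeval (hcomp 2 P) x by have [] := coefs x.
have A0 : A != 0.
  have := fiK (1, 0); case: (fi _) => s x; rewrite fE c0 add0r => -[sA _].
  by apply: contra_eq_neq sA => ->; rewrite mulr0 eq_sym oner_neq0.
pose gi := mk_linear lin_snd \o mk_linear (can2_linear fK fiK) \o j
  : {linear 'cV[K]_n -> 'cV[K]_n}.
have gK : cancel g gi.
  move=> x; have := fK (0, x); rewrite fE c0 mul0r scale0r !addr0 => fix0.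
  by rewrite /gi /= fix0.
have giK : cancel gi g.
  move=> y; rewrite /gi /=; have := fiK (0, y); case: (fi _) => s x /=.
  rewrite fE c0 add0r => -[/eqP]; rewrite mulf_eq0 (negbTE A0) orbF => /eqP ->.
  by rewrite scale0r addr0.
have B0 := shear_eq0 admN admN' ch ch' PE PE' gK giK A0 q2E q3E.
exists g, A^-1; split; [by exists gi | by rewrite invr_eq0 |] => x.
by have := key x; rewrite c0 add0r B0 scaler0 addr0 mulrC => <-; rewrite mulKf.
Qed.

Lemma poly_linear_hcomp (K : numFieldType) n (P P' : {mpoly K[n]}) :
  lin_equiv_poly P P' ->
  exists (c : K) (C : 'M[K]_n), [/\ c != 0, C \in unitmx &
    forall l x, c * mpeval (hcomp l P') x = mpeval (hcomp l P) (C *m x)].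
Proof.
move=> [g [r [[h gK hK] r0 PP']]]; pose hl := mk_linear (can2_linear gK hK).
exists r, (col_matrix hl); split=> // [|l x].
  exact: (col_matrix_unit (f := g)).
rewrite mul_col_matrix; apply/esym; apply: hcomp_proportional => t.
by rewrite PP' linearZ /= hK.
Qed.

(** Polarization recovers the two multilinear forms from the components of
    degree 2 and 3. *)
Lemma hcomp23_calg_iso (K : numFieldType) (N N' : calg K) n
    (P P' : {mpoly K[n]}) c (C : 'M[K]_n) : admissible N -> admissible N' ->
  nil_polynomial N P -> nil_polynomial N' P' -> c != 0 -> C \in unitmx ->
  (forall x, c * mpeval (hcomp 2 P') x = mpeval (hcomp 2 P) (C *m x)) ->
  (forall x, c * mpeval (hcomp 3 P') x = mpeval (hcomp 3 P) (C *m x)) ->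
  calg_iso N N'.
Proof.
move=> admN admN' nilP nilP' c0 Cunit q2E q3E.
have [omega [phi [psi [a [ch PE]]]]] := nil_polynomial_chart admN nilP.
have [omega' [phi' [psi' [a' [ch' PE']]]]] := nil_polynomial_chart admN' nilP'.
pose g : {linear 'cV[K]_n -> 'cV[K]_n} := mulmx C.
have lin0 : linear (fun x : 'cV[K]_n => 0 : K^o).
  by move=> t x y; rewrite scaler0 addr0.
apply: calg_iso_sym.
apply: (calg_iso_forms admN ch' ch (g := g) (c := c^-1)).
- exact: linearP.
- by exists (mulmx (invmx C)) => x; rewrite /g /= ?mulKmx ?mulKVmx.
- by rewrite invr_eq0.
- move=> x y; rewrite -(form2_polarize admN' admN PE' PE (g := g) q2E).
  by rewrite mulKf.
move=> x y z; apply: (mulfI c0); rewrite mulVKf //.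
rewrite (form3_polarize admN' admN PE' PE (g := g) (l := mk_linear lin0)).
  by rewrite /= !mul0r !addr0.
by move=> w; rewrite q3E /= mul0r addr0.
Qed.

Theorem theorem2p11 (R : realType) (n : nat) (N N' : calg R[i])
    (P P' : {mpoly R[i][n]}) :
  admissible N -> admissible N' ->
  nil_polynomial N P -> nil_polynomial N' P' ->
  [/\ graded N -> aff_homogeneous (graph P),
      graded N' -> aff_homogeneous (graph P')
    & aff_homogeneous (graph P) \/ aff_homogeneous (graph P') ->
      [<-> calg_iso N N';
           aff_equiv (graph P) (graph P');
           lin_equiv (graph P) (graph P');
           lin_equiv_poly P P';
           exists (c : R[i]) (C : 'M[R[i]]_n),
             [/\ c != 0, C \in unitmx
               & forall l : nat, l = 2%N \/ l = 3%N -> forall x : 'cV[R[i]]_n,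
                   c * mpeval (hcomp l P') x = mpeval (hcomp l P) (C *m x)]]].
Proof.
move=> admN admN' nilP nilP'; split=> [||hom].
- exact: graded_homogeneous.
- exact: graded_homogeneous.
tfae.
- exact: calg_iso_affine.
- exact: affine_graph_linear nilP nilP' hom.
- exact: graph_linear_poly admN admN' nilP nilP'.
- move=> /poly_linear_hcomp[c [C [c0 Cunit qE]]].
  by exists c, C; split=> // l _; apply: qE.
move=> [c [C [c0 Cunit qE]]].
apply: (hcomp23_calg_iso admN admN' nilP nilP' c0 Cunit).
  by apply: qE; left.
by apply: qE; right.
Qed.
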